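(* Let $k$ be odd and $\ell=\lceil k/2\rceil$. (1) The components of $\mathbf{DCM}_k$ of smallest order are isolated vertices, and there are exactly $\frac{1}{\ell}\binom{4\ell-2}{\ell-1}$ of them. (2) For $k\ge 3$, the components of $\mathbf{DCM}_k$ of second smallest order are stars $K_{1,\ell-1}$ (of order $\ell$), and for $k\ge 5$ there are exactly $(2\ell-1)\cdot 2^{\ell-3}$ of them.
   Context: Let $k\ge 1$ and let $X_{2k}=\{P_1,\dots,P_{2k}\}$ be $2k$ points in convex position in the plane, labeled in clockwise cyclic order; indices are taken modulo $2k$. A matching of $X_{2k}$ means a set of $k$ pairwise non-crossing straight segments (edges) with endpoints in $X_{2k}$ covering every point exactly once; its size is $k$. Two matchings $M,M'$ of $X_{2k}$ are disjoint compatible if they have no common edge and no edge of $M$ crosses an edge of $M'$. $\mathbf{DCM}_k$ is the graph whose vertices are the matchings of $X_{2k}$, two being adjacent iff they are disjoint compatible. The order of a component is its number of vertices. *)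

(* Defs.v *)
From mathcomp Require Import all_boot.
Set Implicit Arguments. Unset Strict Implicit. Unset Printing Implicit Defensive.

(* Points of X_{2k}: P_1..P_{2k} in clockwise order are encoded as 0..2k-1 : 'I_(k.*2). *)
Definition point (k : nat) := 'I_(k.*2).

Definition cross_ord (k : nat) (e f : {set point k}) : bool :=
  [exists a : point k, exists b : point k, exists c : point k, exists d : point k,
     [&& e == [set a; b], f == [set c; d], (a < c)%N, (c < b)%N & (b < d)%N]].

(* Two straight segments between points in convex position cross iff their
   endpoints strictly interleave in the cyclic order. *)
Definition crossing (k : nat) (e f : {set point k}) : bool :=
  cross_ord e f || cross_ord f e.

Definition is_matching (k : nat) (M : {set {set point k}}) : bool :=
  [&& [forall e in M, #|e| == 2],
      [forall p : point k, #|[set e in M | p \in e]| == 1] &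
      [forall e in M, forall f in M, ~~ crossing e f]].

Definition matching (k : nat) := {M : {set {set point k}} | is_matching M}.

Definition dcm (k : nat) : rel (matching k) :=
  fun M M' => [disjoint val M & val M'] &&
              [forall e in val M, forall f in val M', ~~ crossing e f].

Definition component (k : nat) (M : matching k) : {set matching k} :=
  [set M' | connect (@dcm k) M M'].

Definition components (k : nat) : {set {set matching k}} :=
  [set component M | M : matching k].

Definition is_star (k : nat) (C : {set matching k}) : bool :=
  [exists c in C, forall x in C, forall y in C,
     dcm x y == ((x == c) && (y != c)) || ((y == c) && (x != c))].

(* Main.v *)
From HB Require Import structures.
Require Import Defs.
From mathcomp Require Import all_boot zify.

Set Implicit Arguments. Unset Strict Implicit. Unset Printing Implicit Defensive.

(* Idea.  The regions cut out by a matching M form a plane tree (dual tree) whose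
   edges are the edges of M.  In a disjoint compatible matching every edge of M
   is flipped within one of its two sides, together with at least one other edge;
   so the neighbours of M correspond to orientations of the dual tree without
   vertex of indegree 1 (and a choice within each vertex).

   Replacing a block (()) by an antiblock ()() on four consecutive points is
   always such a flip, and the block admits no other one.  Hence inserting a
   block neither creates nor destroys neighbours.  As matchings of even size are
   never isolated, for odd k the isolated matchings are those that reduce to a
   single edge by deleting blocks; they are triples of quaternary trees.

   If M is not isolated, its component contains, up to rotation, a matching
   ()() M' with M' not isolated.  The component of M' lifts to distinct vertices
   in which the four new points are matched among themselves, and for odd size
   ()() M' has a further neighbour that is not of this kind.  By induction this
   gives order at least l.  If the order is l there is only one further vertex,
   which by induction forces the dual tree of some vertex of the component to be
   a caterpillar with all inner vertices of degree 3.  Conversely, peeling off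
   the antiblocks at the ends of such a caterpillar shows that it is the centre
   of a star component. *)

(** * Forests and the compatibility relation *)

(* [Node c r] is the balanced word [(c) r], read along the points [0, 1, ...]: an
   edge at the first point enclosing [c], followed by [r]. *)
Inductive forest := Emp | Node (c r : forest).

Fixpoint forest_code F : GenTree.tree unit :=
  if F is Node c r then GenTree.Node 0 [:: forest_code c; forest_code r]
  else GenTree.Leaf tt.

Fixpoint forest_decode (t : GenTree.tree unit) : option forest :=
  if t is GenTree.Node _ [:: c; r] then
    if (forest_decode c, forest_decode r) is (Some c', Some r')
    then Some (Node c' r') else None
  else Some Emp.

Lemma forest_codeK : pcancel forest_code forest_decode.
Proof. by elim=> //= c -> r ->. Qed.

HB.instance Definition _ := Choice.copy forest (pcan_type forest_codeK).

Fixpoint fsize F := if F is Node c r then (fsize c + fsize r).+1 else 0.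

Fixpoint fcat F G := if F is Node c r then Node c (fcat r G) else G.

(** The points of [Node c r] are, in order, the opening point [0], those of [c], the closing point
    [m.+1], and those of [r]. The value is meaningful only for [i < (fsize F).*2]. *)
Fixpoint mate F i :=
  if F is Node c r then
    let m := (fsize c).*2 in
    if i == 0 then m.+1 else if i <= m then (mate c i.-1).+1
    else if i == m.+1 then 0 else m.+2 + mate r (i - m.+2)
  else 0.

(* The lower bound on [i] below catches every crossing: one of two crossing
   edges has an endpoint strictly inside the other. *)
Definition adj F G :=
  let n := (fsize F).*2 in
  (fsize F == fsize G) &&
  all (fun i => (mate F i != mate G i) &&
         all (fun j => (i < j < mate F i) ==> (i <= mate G j <= mate F i))
             (iota 0 n)) (iota 0 n).

(** The points of [f] form a consecutive run placed just before point [i] of [G]; the gap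
    [i = (fsize G).*2] is at the very end. *)
Fixpoint ins i f G :=
  if G is Node c r then
    if i == 0 then fcat f G
    else if i <= (fsize c).*2.+1 then Node (ins i.-1 f c) r
    else Node c (ins (i - (fsize c).*2.+2) f r)
  else f.

Lemma fsize_cat F G : fsize (fcat F G) = fsize F + fsize G.
Proof. by elim: F => //= c _ r ->; lia. Qed.

Lemma fcats0 F : fcat F Emp = F.
Proof. by elim: F => //= c _ r ->. Qed.

Lemma fcatA F G H : fcat (fcat F G) H = fcat F (fcat G H).
Proof. by elim: F => //= c _ r ->. Qed.

Lemma fsize_ins i f G : fsize (ins i f G) = fsize f + fsize G.
Proof.
elim: G i => [|c IHc r IHr] i /=; first lia.
by case: ifP => _; [rewrite fsize_cat /=|case: ifP => _ /=; rewrite (IHc, IHr)]; lia.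
Qed.

Lemma ins0 f G : ins 0 f G = fcat f G.
Proof. by case: G => //=; rewrite fcats0. Qed.

Lemma ins_nil i G : ins i Emp G = G.
Proof.
by elim: G i => [|c IHc r IHr] i //=; do 2?case: ifP => // _; rewrite (IHc, IHr).
Qed.

Lemma ins_catl i f F G : i <= (fsize F).*2 -> ins i f (fcat F G) = fcat (ins i f F) G.
Proof.
elim: F i => [|c _ r IHr] i /=; first by rewrite leqn0 => /eqP->; apply: ins0.
move=> le_i; case: ifP => _; first by rewrite fcatA.
by case: ifP => //= i_c; rewrite IHr //; lia.
Qed.

Lemma ins_catr i f F G : ins ((fsize F).*2 + i) f (fcat F G) = fcat F (ins i f G).
Proof.
elim: F => //= c _ r IHr.
by rewrite -{}IHr ifF; [congr (Node _ (ins _ _ _))|]; lia.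
Qed.

Variant node_spec (c r : forest) : nat -> nat -> Prop :=
  | NodeOpen : node_spec c r 0 (fsize c).*2.+1
  | NodeIn j of j < (fsize c).*2 : node_spec c r j.+1 (mate c j).+1
  | NodeClose : node_spec c r (fsize c).*2.+1 0
  | NodeOut j of j < (fsize r).*2 :
      node_spec c r ((fsize c).*2.+2 + j) ((fsize c).*2.+2 + mate r j).

Lemma nodeP c r i : i < (fsize (Node c r)).*2 -> node_spec c r i (mate (Node c r) i).
Proof.
rewrite /= => lt_i; case: eqP => [->|/eqP i0]; first exact: NodeOpen.
case: leqP => [i_c|c_i].
  by case: i i0 i_c {lt_i} => // i _ i_c; apply: NodeIn.
case: eqP => [->|/eqP i_c]; first exact: NodeClose.
rewrite -[X in node_spec c r X](@subnKC (fsize c).*2.+2); last lia.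
by apply: NodeOut; lia.
Qed.

Lemma mate_in c r j : j < (fsize c).*2 -> mate (Node c r) j.+1 = (mate c j).+1.
Proof. by move=> lt_j /=; rewrite lt_j. Qed.

Lemma mate_close c r : mate (Node c r) (fsize c).*2.+1 = 0.
Proof. by rewrite /= ltnn eqxx. Qed.

Lemma mate_out c r j : mate (Node c r) ((fsize c).*2.+2 + j) = (fsize c).*2.+2 + mate r j.
Proof.
rewrite /= ifF; last lia.
by rewrite ifF; [congr (_ + mate _ _)|]; lia.
Qed.

Lemma mate_lt F i : i < (fsize F).*2 -> mate F i < (fsize F).*2.
Proof.
elim: F i => // c IHc r IHr i lt_i; case: (nodeP lt_i) => /= [|j /IHc||j /IHr]; lia.
Qed.

Lemma mateK F i : i < (fsize F).*2 -> mate F (mate F i) = i.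
Proof.
elim: F i => // c IHc r IHr i lt_i.
case: (nodeP lt_i) => [|j j_c||j j_r]; first exact: mate_close.
- by rewrite mate_in ?mate_lt ?IHc.
- by [].
- by rewrite mate_out IHr.
Qed.

Lemma mate_neq F i : i < (fsize F).*2 -> mate F i != i.
Proof.
elim: F i => // c IHc r IHr i lt_i; case: (nodeP lt_i) => [|j /IHc||j /IHr]; lia.
Qed.

Lemma mate_nc F i j : j < (fsize F).*2 -> i < j < mate F i -> i < mate F j < mate F i.
Proof.
elim: F i j => // c IHc r IHr i j lt_j /andP[lt_ij lt_jm].
have lt_i := ltn_trans lt_ij lt_j; move: lt_ij lt_jm.
case: (nodeP lt_i) => [|i' i_c||i' i_r].
- case: (nodeP lt_j) => [|j' j_c||j' j_r]; try lia.
  by have := mate_lt j_c; lia.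
- have := mate_lt i_c; case: (nodeP lt_j) => [|j' j_c||j' j_r]; try lia.
  by have := IHc i' j' j_c; lia.
- lia.
- case: (nodeP lt_j) => [|j' j_c||j' j_r]; try lia.
  by have := IHr i' j' j_r; lia.
Qed.

Lemma mate_inj F G : fsize F = fsize G ->
  (forall i, i < (fsize F).*2 -> mate F i = mate G i) -> F = G.
Proof.
elim: F G => [|c IHc r IHr] [|c' r'] // eq_sz eq_m.
have eq_c : fsize c = fsize c' by have /= := eq_m 0 (ltn0Sn _); lia.
have eq_r : fsize r = fsize r' by move: eq_sz => /=; lia.
congr Node.
  apply: IHc => // i lt_i; apply: succn_inj.
  by rewrite -(mate_in r) // -(mate_in r') -?eq_c // eq_m //=; lia.
apply: IHr => // i lt_i; apply: (@addnI (fsize c).*2.+2).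
rewrite -mate_out {2}eq_c -mate_out -eq_c eq_m //=; lia.
Qed.

Lemma mate_cat F G i :
  mate (fcat F G) i =
    if i < (fsize F).*2 then mate F i else (fsize F).*2 + mate G (i - (fsize F).*2).
Proof.
elim: F i => [|c _ r IHr] i; first by rewrite /= subn0.
rewrite /= IHr; case: eqP => [->|/eqP i0] //.
have -> : i - (fsize c).*2.+2 - (fsize r).*2 = i - (fsize c + fsize r).+1.*2 by lia.
do 4?case: ifP; lia.
Qed.

(** New position of the point [x] of [G] in [ins i f G], where [f] has [m] points. *)
Definition skip i m x := if x < i then x else x + m.

Lemma mate_ins i f G j : i <= (fsize G).*2 -> j < (fsize f + fsize G).*2 ->
  mate (ins i f G) j =
    if j < i then skip i (fsize f).*2 (mate G j)
    else if j < i + (fsize f).*2 then i + mate f (j - i)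
    else skip i (fsize f).*2 (mate G (j - (fsize f).*2)).
Proof.
rewrite /skip; elim: G i j => [|c IHc r IHr] i j.
  by rewrite leqn0 addn0 => /eqP-> /= lt_j; rewrite subn0 lt_j.
rewrite [ins _ _ _]/=; case: eqP => [-> _|/eqP i0 le_i] lt_j.
  by rewrite mate_cat subn0 !add0n !ltn0; case: ifP => // _; rewrite addnC.
case: (leqP i (fsize c).*2.+1) => i_c.
  have lt_j' : j < (fsize (Node (ins i.-1 f c) r)).*2
    by rewrite /= fsize_ins; move: lt_j => /=; lia.
  case: (nodeP lt_j') => [|j' ||j' ]; rewrite ?fsize_ins.
  - by rewrite lt0n i0 /=; case: ifP; lia.
  - move=> j_c; rewrite IHc; try lia.
    have -> : (j'.+1 < i) = (j' < i.-1) by lia.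
    have -> : (j'.+1 < i + (fsize f).*2) = (j' < i.-1 + (fsize f).*2) by lia.
    case: ltnP => j_i; first by rewrite mate_in; [case: ifP; case: ifP|]; lia.
    case: ltnP => j_f; first by have -> : j'.+1 - i = j' - i.-1; lia.
    have -> : j'.+1 - (fsize f).*2 = (j' - (fsize f).*2).+1 by lia.
    by rewrite mate_in; [case: ifP; case: ifP|]; lia.
  - rewrite 2?ifF; try lia.
    have -> : (fsize f + fsize c).*2.+1 - (fsize f).*2 = (fsize c).*2.+1 by lia.
    by rewrite mate_close ifT //; lia.
  - move=> j_r; rewrite 2?ifF; try lia.
    have -> : (fsize f + fsize c).*2.+2 + j' - (fsize f).*2 = (fsize c).*2.+2 + j' by lia.
    by rewrite mate_out ifF; lia.
have lt_j' : j < (fsize (Node c (ins (i - (fsize c).*2.+2) f r))).*2.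
  by rewrite /= fsize_ins; move: lt_j => /=; lia.
have le_i' : i - (fsize c).*2.+2 <= (fsize r).*2 by move: le_i => /=; lia.
case: (nodeP lt_j') => [|j' j_c||j' ]; rewrite ?fsize_ins.
- by rewrite lt0n i0 /=; case: ifP; lia.
- rewrite ifT; last lia.
  by rewrite mate_in //; have := mate_lt j_c; case: ifP; lia.
- by rewrite mate_close; case: ifP; case: ifP; lia.
move=> j_r; rewrite IHr; try lia.
have -> : ((fsize c).*2.+2 + j' < i) = (j' < i - (fsize c).*2.+2) by lia.
have -> : ((fsize c).*2.+2 + j' < i + (fsize f).*2) =
  (j' < i - (fsize c).*2.+2 + (fsize f).*2) by lia.
case: ltnP => j_i; first by rewrite mate_out; case: ifP; case: ifP; lia.
case: ltnP => j_f.
  by have -> : (fsize c).*2.+2 + j' - i = j' - (i - (fsize c).*2.+2); lia.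
have -> : (fsize c).*2.+2 + j' - (fsize f).*2 = (fsize c).*2.+2 + (j' - (fsize f).*2) by lia.
by rewrite mate_out; case: ifP; case: ifP; lia.
Qed.

Lemma skip_inj i m : injective (skip i m).
Proof. by rewrite /skip => x y; do 2!case: ifP; lia. Qed.

Variant ins_point_spec i m g : nat -> Prop :=
  | InsOut x of x < g : ins_point_spec i m g (skip i m x)
  | InsIn y of y < m : ins_point_spec i m g (i + y).

Lemma ins_pointP i m g j : i <= g -> j < m + g -> ins_point_spec i m g j.
Proof.
move=> le_i lt_j; case: (ltnP j i) => j_i.
  have -> : j = skip i m j by rewrite /skip j_i.
  by apply: InsOut; lia.
case: (ltnP j (i + m)) => j_im.
  by rewrite -(subnKC j_i); apply: InsIn; lia.
have -> : j = skip i m (j - m) by rewrite /skip; case: ifP; lia.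
by apply: InsOut; lia.
Qed.

Lemma mate_ins_in i f G y : i <= (fsize G).*2 -> y < (fsize f).*2 ->
  mate (ins i f G) (i + y) = i + mate f y.
Proof.
move=> le_i lt_y; rewrite mate_ins //; last lia.
by rewrite ifF ?ifT ?addKn //; lia.
Qed.

Lemma mate_ins_out i f G x : i <= (fsize G).*2 -> x < (fsize G).*2 ->
  mate (ins i f G) (skip i (fsize f).*2 x) = skip i (fsize f).*2 (mate G x).
Proof.
move=> le_i lt_x; rewrite mate_ins //; last by rewrite /skip; case: ifP; lia.
case: (ltnP x i) => x_i.
  by rewrite [skip _ _ x]/skip x_i x_i.
have ->: skip i (fsize f).*2 x = x + (fsize f).*2 by rewrite {1}/skip ifF; lia.
by rewrite addnK 2?ifF //; lia.
Qed.

Lemma adjP F G :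
  reflect [/\ fsize F = fsize G,
     forall i, i < (fsize F).*2 -> mate F i != mate G i &
     forall i j, j < (fsize F).*2 -> i < j < mate F i -> i <= mate G j <= mate F i]
  (adj F G).
Proof.
apply: (iffP andP) => [[/eqP eq_sz /allP allF]|[eq_sz disj nc]].
  split=> // [i lt_i|i j lt_j /[dup] ltij /andP[lt_ij lt_jm]].
    by have /andP[] := allF i ltac:(by rewrite mem_iota).
  have /andP[_ /allP/(_ j)] := allF i ltac:(by rewrite mem_iota; lia).
  by rewrite mem_iota add0n => /(_ lt_j)/implyP; apply.
split; first exact/eqP.
apply/allP => i; rewrite mem_iota => /= lt_i; rewrite disj //=.
by apply/allP => j; rewrite mem_iota => /= lt_j; apply/implyP; apply: nc.
Qed.

Lemma adj_size F G : adj F G -> fsize F = fsize G.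
Proof. by case/adjP. Qed.

Lemma adj_sym F G : adj F G -> adj G F.
Proof.
case/adjP=> eq_sz disj nc; apply/adjP; split=> // [i lt_i|i j lt_j ltij].
  by rewrite eq_sym disj ?eq_sz.
rewrite -eq_sz in lt_j.
have lt_mj := mate_lt lt_j.
have lt_i : i < (fsize F).*2 by lia.
have Kj := mateK lt_j.
have lt_gi : mate G i < (fsize F).*2 by rewrite eq_sz mate_lt -?eq_sz.
have Ki : mate G (mate G i) = i by rewrite mateK -?eq_sz.
(* If [mate F j] left the interval of the [G]-edge at [i], then [mate G i] or [i] would lie strictly
   inside the [F]-edge at [j] while its partner lies outside; the two instances cover the two
   directions. *)
have h1 := nc j (mate G i) lt_gi; have h2 := nc (mate F j) i lt_i.
by rewrite {}Kj {}Ki in h1 h2; lia.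
Qed.

Lemma adj_irr F : 0 < fsize F -> adj F F = false.
Proof. by move=> F0; apply/negP => /adjP[_ /(_ 0)]; rewrite eqxx; lia. Qed.

(** Edges of an inserted run never cross edges of the rest, so compatibility can be tested
    separately on the run and on the rest. *)
Lemma adj_ins i f f' G G' : i <= (fsize G).*2 ->
  adj f f' -> adj G G' -> adj (ins i f G) (ins i f' G').
Proof.
move=> le_i /adjP[sz_f df nf] /adjP[sz_G dG nG].
have m_in y : y < (fsize f).*2 -> mate (ins i f' G') (i + y) = i + mate f' y.
  by move=> lt_y; rewrite mate_ins_in -?sz_f -?sz_G.
have m_out x : x < (fsize G).*2 ->
    mate (ins i f' G') (skip i (fsize f).*2 x) = skip i (fsize f).*2 (mate G' x).
  by move=> lt_x; rewrite sz_f mate_ins_out -?sz_G.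
apply/adjP; split=> [|a|a b]; rewrite !fsize_ins ?doubleD; first by rewrite sz_f sz_G.
  case/(ins_pointP le_i) => [x lt_x|y lt_y].
    by rewrite mate_ins_out // m_out // (inj_eq (@skip_inj _ _)) dG.
  by rewrite mate_ins_in // m_in // eqn_add2l df.
move=> /[dup] lt_b /(ins_pointP le_i) zb /andP[lt_ab].
have lt_a := ltn_trans lt_ab lt_b; case/(ins_pointP le_i): lt_a lt_ab => [x lt_x|x lt_x].
  rewrite mate_ins_out //; case: zb {lt_b} => y lt_y.
    rewrite m_out //; have := nG x y lt_y.
    by rewrite /skip; do 4![case: ifP => ?]; lia.
  have : mate f' y < (fsize f).*2 by rewrite sz_f mate_lt -?sz_f.
  by rewrite m_in // /skip; do 2![case: ifP => ?]; lia.
have lt_fx := mate_lt lt_x; rewrite mate_ins_in //.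
case: zb {lt_b} => y lt_y; first by rewrite /skip; case: ifP => ?; lia.
by rewrite m_in // => ? ?; have := nf x y lt_y; lia.
Qed.

Lemma adj_insE i f f' G G' : i <= (fsize G).*2 -> fsize f = fsize f' ->
  adj (ins i f G) (ins i f' G') -> adj f f' /\ adj G G'.
Proof.
move=> le_i sz_f /adjP[]; rewrite !fsize_ins -sz_f => /addnI sz_G disj nc.
have m_in y : y < (fsize f).*2 -> mate (ins i f' G') (i + y) = i + mate f' y.
  by move=> lt_y; rewrite mate_ins_in -?sz_f -?sz_G.
have m_out x : x < (fsize G).*2 ->
    mate (ins i f' G') (skip i (fsize f).*2 x) = skip i (fsize f).*2 (mate G' x).
  by move=> lt_x; rewrite sz_f mate_ins_out -?sz_G.
have lt_skip x : x < (fsize G).*2 -> skip i (fsize f).*2 x < (fsize f + fsize G).*2.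
  by rewrite /skip; case: ifP; lia.
split; apply/adjP; split=> // x.
- by move=> lt_x; have := disj (i + x); rewrite mate_ins_in // m_in // eqn_add2l; apply; lia.
- by move=> y lt_y lt_xy; have := nc (i + x) (i + y); rewrite mate_ins_in ?m_in //; lia.
- move=> lt_x; have := disj _ (lt_skip x lt_x).
  by rewrite mate_ins_out // m_out // (inj_eq (@skip_inj _ _)).
- move=> y lt_y lt_xy; have := nc (skip i (fsize f).*2 x) _ (lt_skip y lt_y).
  rewrite mate_ins_out ?m_out //; last lia.
  by rewrite /skip; do 4![case: ifP => ?]; lia.
Qed.

(** The parameter [m] counts edges: the run consists of the [m.*2] points from [i] on. *)
Definition stable H i m := all (fun j => i <= mate H j < i + m.*2) (iota i m.*2).

Lemma stableP H i m :
  reflect (forall j, i <= j < i + m.*2 -> i <= mate H j < i + m.*2) (stable H i m).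
Proof.
by apply: (iffP allP) => h j; have := h j; rewrite mem_iota.
Qed.

(** A run of points matched among themselves can be cut out; this is how a factorization is
    recovered from information on [mate] alone. *)
Lemma stable_split H i m g : fsize H = m + g -> i <= g.*2 -> stable H i m ->
  exists f G, [/\ fsize f = m, fsize G = g & H = ins i f G].
Proof.
move=> szH le_i /stableP; case: (posnP m) => [m0 _|m_gt0].
  by exists Emp, H; rewrite ins_nil szH m0.
elim: H i m g m_gt0 szH le_i => [|c IHc r IHr] i m g m_gt0 szH le_i clH;
  first by rewrite /= in szH; lia.
rewrite /= in szH; case: (posnP i) => [i0|i_gt0].
  (* A run starting at [0] contains the whole first tree, and either stops there or continues in
     [r]. *)
  have /= c_m := clH 0; have [m_c|lt_c] := eqVneq m (fsize c).+1.
    exists (Node c Emp), r; rewrite i0 ins0 /=; split=> //; lia.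
  have [|||j j_in|f [G [szf szG ->]]] := IHr 0 (m - (fsize c).+1) g; try lia.
    have := clH ((fsize c).*2.+2 + j); rewrite mate_out; lia.
  by exists (Node c f), G; rewrite i0 !ins0 /=; split=> //; lia.
(* The closing point is matched to [0], which precedes the run, so the run cannot contain it and
   lies within [c] or within [r]. *)
have := clH (fsize c).*2.+1; rewrite mate_close => cl_c.
case: (leqP i (fsize c).*2.+1) => i_c.
  have [|||j j_in|f [G [szf szG e]]] := IHc i.-1 m (fsize c - m); try lia.
    have := clH j.+1; rewrite mate_in; lia.
  exists f, (Node G r); rewrite /= szf szG; split=> //; first lia.
by rewrite ifF -?e ?ifT //; lia.
have [|||j j_in|f [G [szf szG e]]] := IHr (i - (fsize c).*2.+2) m (fsize r - m); try lia.
  have := clH ((fsize c).*2.+2 + j); rewrite mate_out; lia.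
exists f, (Node c G); rewrite /= szf szG; split=> //; first lia.
by rewrite ifF -?e ?ifF //; lia.
Qed.

Lemma stable_ins i f G : i <= (fsize G).*2 -> stable (ins i f G) i (fsize f).
Proof.
move=> le_i; apply/stableP => j j_in; rewrite -(subnKC (n := j) (m := i)); last lia.
by rewrite mate_ins_in //; [have := mate_lt (F := f) (i := j - i)|]; lia.
Qed.

Lemma stable_ins_front i f G m : m.*2 <= i -> i <= (fsize G).*2 ->
  stable (ins i f G) 0 m = stable G 0 m.
Proof.
move=> le_m le_i; apply: eq_in_all => j; rewrite mem_iota !add0n => /= lt_j.
have {1}-> : j = skip i (fsize f).*2 j by rewrite /skip ifT //; lia.
by rewrite mate_ins_out //; [rewrite /skip; case: ifP|]; lia.
Qed.

Lemma ins_inj i f f' G G' : i <= (fsize G).*2 -> fsize f = fsize f' ->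
  ins i f G = ins i f' G' -> f = f' /\ G = G'.
Proof.
move=> le_i sz_f e.
have sz_G : fsize G = fsize G' by have := congr1 fsize e; rewrite !fsize_ins; lia.
split; apply: mate_inj => // x lt_x.
  by apply: (@addnI i); rewrite -(mate_ins_in le_i lt_x) e mate_ins_in -?sz_G -?sz_f.
apply: (@skip_inj i (fsize f).*2).
by rewrite -mate_ins_out // e sz_f mate_ins_out -?sz_G.
Qed.

(** * Blocks, antiblocks and rings as local pieces of a matching *)

Notation leaf := (Node Emp Emp).
Definition block := Node leaf Emp.
Definition antiblock := Node Emp leaf.
(** [ring3] is [()()()] and [ring3'] is [(()())]: the two matchings of a hexagon by boundary edges.
    Each is the only neighbour of the other. *)
Definition ring3 := Node Emp antiblock.
Definition ring3' := Node antiblock Emp.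

Lemma fsize0 F : fsize F = 0 -> F = Emp.
Proof. by case: F. Qed.

Lemma fsize1 F : fsize F = 1 -> F = leaf.
Proof. by case: F => //= [[|? ?]] [|? ?] //=; lia. Qed.

Lemma fsize2 F : fsize F = 2 -> F = block \/ F = antiblock.
Proof.
case: F => //= c r; case: (posnP (fsize c)) => [/fsize0->|c0] sz.
  by right; rewrite (@fsize1 r) //; move: sz => /=; lia.
have [-> ->] : c = leaf /\ r = Emp by split; [apply: fsize1|apply: fsize0]; lia.
by left.
Qed.

(** The endpoints of the inner edge must be rematched below the outer edge, which leaves only the
    antiblock. The four points are then closed under [H], so the rest is an independent neighbour of
    [G]. *)
Lemma adj_block i G H : i <= (fsize G).*2 -> adj (ins i block G) H ->
  exists2 G', H = ins i antiblock G' & adj G G'.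
Proof.
move=> le_i adjH; have /adjP[] := adjH; rewrite fsize_ins => szH disj nc.
have mF y : y < 4 -> mate (ins i block G) (i + y) = i + (3 - y).
  by move=> lt_y; rewrite mate_ins_in //; case: y lt_y => [|[|[|[]]]].
have mH y : y < 4 -> mate H (i + y) < (fsize H).*2 /\ mate H (mate H (i + y)) = i + y.
  by move=> lt_y; rewrite mateK ?mate_lt // -szH /=; lia.
have nc1 := nc (i + 0) (i + 1); have nc2 := nc (i + 0) (i + 2).
have d1 := disj (i + 1); rewrite !mF //= in nc1 nc2 d1.
have [? K1] := mH 1 isT; have [? K2] := mH 2 isT.
have ncH := @mate_nc H i (i + 1).
have {}m1 : mate H (i + 1) = i.
  have [//|e] : mate H (i + 1) = i \/ mate H (i + 1) = i + 3.
    by have := @mate_neq H (i + 1); move: nc1 d1; rewrite /=; lia.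
  (* With [i + 1] matched to [i + 3], only [i] is left for [i + 2], and these two edges cross. *)
  have m2 : mate H (i + 2) = i.
    have : mate H (i + 2) != i + 1 by apply/eqP => e'; move: K2; rewrite e' e; lia.
    have : mate H (i + 2) != i + 3 by apply/eqP => e'; move: K2; rewrite e' -e K1; lia.
    by have := @mate_neq H (i + 2); move: nc2; rewrite /=; lia.
  by move: K2 ncH; rewrite m2 => ->; rewrite e; lia.
have m2 : mate H (i + 2) = i + 3.
  have : mate H (i + 2) != i + 1 by apply/eqP => e'; move: K2; rewrite e' m1; lia.
  have : mate H (i + 2) != i by apply/eqP => e'; move: K2; rewrite e' -m1 K1; lia.
  by have := @mate_neq H (i + 2); move: nc2; rewrite /=; lia.
have clH : stable H i 2.
  apply/stableP => j j_in; have [->|[->|[->|->]]] :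
    j = i \/ j = i + 1 \/ j = i + 2 \/ j = i + 3 by lia.
  - by rewrite -{2 3}m1 K1; lia.
  - by rewrite m1; lia.
  - by rewrite m2; lia.
  - by rewrite -m2 K2; lia.
have [f [G' [szf szG' eH]]] := stable_split (esym szH) le_i clH.
have [adjf adjG] : adj block f /\ adj G G' by apply: (@adj_insE i); rewrite ?szf -?eH.
by exists G' => //; rewrite eH; case: (fsize2 szf) adjf => ->.
Qed.

Lemma factor2 F : 1 < fsize F ->
  exists i b G, [/\ i <= (fsize G).*2, b = block \/ b = antiblock & F = ins i b G].
Proof.
elim: F => // c IHc r IHr /= sz.
case: (leqP 2 (fsize c)) => [/IHc[i [b [G [le_i bP ->]]]]|c1].
  by exists i.+1, b, (Node G r); split=> //=; [lia|rewrite ifT //; lia].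
case: (leqP 2 (fsize r)) => [/IHr[i [b [G [le_i bP ->]]]]|r1].
  exists ((fsize c).*2.+2 + i), b, (Node c G); split=> //=; first lia.
  by rewrite ifF ?addKn //; lia.
have [c0|c0] := posnP (fsize c).
  exists 0, antiblock, Emp; split=> //; first by right.
  by rewrite (fsize0 c0) (@fsize1 r) //; lia.
by exists 0, block, r; split=> //; [left|rewrite (@fsize1 c) ?ins0 //; lia].
Qed.

(** Antiblocks are avoided here because a neighbour may rematch their points with outside ones. A
    block forces its neighbours, while cutting off a ring from an odd forest leaves an even one,
    which has a neighbour. *)
Lemma factor3 F : 2 < fsize F ->
  exists i b G, [/\ i <= (fsize G).*2, b \in [:: block; ring3'; ring3] & F = ins i b G].
Proof.
elim: F => // c IHc r IHr /= sz.
case: (leqP 3 (fsize c)) => [/IHc[i [b [G [le_i bP ->]]]]|c2].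
  by exists i.+1, b, (Node G r); split=> //=; [lia|rewrite ifT //; lia].
case: (leqP 3 (fsize r)) => [/IHr[i [b [G [le_i bP ->]]]]|r2].
  exists ((fsize c).*2.+2 + i), b, (Node c G); split=> //=; first lia.
  by rewrite ifF ?addKn //; lia.
have [c0|c_gt0] := posnP (fsize c).
  have [->|->] : r = block \/ r = antiblock by apply: fsize2; lia.
    by exists 2, block, leaf; rewrite (fsize0 c0).
  by exists 0, ring3, Emp; rewrite (fsize0 c0).
have [c1|c1] := eqVneq (fsize c) 1.
  by exists 0, block, r; rewrite (fsize1 c1) ins0.
have [->|->] : c = block \/ c = antiblock by apply: fsize2; lia.
  by exists 1, block, (Node Emp r).
by exists 0, ring3', r; rewrite ins0.
Qed.

Lemma flip2 b : b = block \/ b = antiblock ->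
  exists b', [/\ b' = block \/ b' = antiblock, fsize b = 2 & adj b b'].
Proof. by case=> ->; [exists antiblock|exists block]; split; auto. Qed.

(** Cutting out blocks and antiblocks exhausts a forest of even size, and all of them can be flipped
    independently. *)
Lemma adj_even F : ~~ odd (fsize F) -> exists G, adj F G.
Proof.
have [n] := ubnP (fsize F); elim: n F => // n IHn F le_n ev.
have [F0|F_gt0] := posnP (fsize F); first by exists Emp; rewrite (fsize0 F0).
have [i [b [G [le_i /flip2[b' [_ szb adjb]] eF]]]] : exists i b G,
  [/\ i <= (fsize G).*2, b = block \/ b = antiblock & F = ins i b G] by apply: factor2; lia.
have szF : fsize F = (fsize G).+2 by rewrite eF fsize_ins szb.
have [||G' adjG] := IHn G; try lia.
by exists (ins i b' G'); rewrite eF adj_ins.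
Qed.

Lemma adj_fsize3 F X : fsize F = 3 -> adj F X -> F = ring3 \/ F = ring3'.
Proof.
move=> szF adjX; have [|i [b [G [le_i bP eF]]]] := @factor3 F; first lia.
have sz_bG : fsize b + fsize G = 3 by rewrite -(fsize_ins i) -eF.
have [eb|b_ring] := eqVneq b block.
  rewrite eb /= in sz_bG; move: adjX; rewrite eF eb => /(adj_block le_i)[Y _ adjGY].
  have eG : G = leaf by apply: fsize1; lia.
  have eY : Y = leaf by apply: fsize1; rewrite -(adj_size adjGY) eG.
  by move: adjGY; rewrite eG eY adj_irr.
move: bP; rewrite !inE (negPf b_ring) /= => bP.
have szb : fsize b = 3 by case/orP: bP => /eqP->.
have eG : G = Emp by apply: fsize0; lia.
move: le_i; rewrite eF eG leqn0 => /eqP->; case/orP: bP => /eqP->; auto.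
Qed.

(** * Rotations and components *)

(* The points are relabelled by [i |-> i - 1] modulo their number. *)
Definition rot1 F := if F is Node c r then fcat c (Node r Emp) else Emp.

Fixpoint unrot1 F :=
  if F is Node c r then
    if unrot1 r is Node c' r' then Node (Node c c') r' else Node Emp c
  else Emp.

Lemma unrot1_cat c r : unrot1 (fcat c (Node r Emp)) = Node c r.
Proof. by elim: c => //= c _ c' ->. Qed.

Lemma rot1K : cancel rot1 unrot1.
Proof. by case=> // c r; apply: unrot1_cat. Qed.

Lemma unrot1K : cancel unrot1 rot1.
Proof.
elim=> // c _ r /=; case: (unrot1 r) => [<-|c' r' /= <-] //.
Qed.

Lemma fsize_rot1 F : fsize (rot1 F) = fsize F.
Proof. by case: F => //= c r; rewrite fsize_cat /=; lia. Qed.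

Lemma mate_rot1 F j : j < (fsize F).*2 ->
  mate (rot1 F) j =
    let m := mate F (if j.+1 == (fsize F).*2 then 0 else j.+1) in
    if m == 0 then (fsize F).*2.-1 else m.-1.
Proof.
case: F => // c r lt_j; rewrite [rot1 _]/= mate_cat.
case: ltnP => [j_c|c_j].
  by rewrite ifF ?mate_in //=; lia.
have [x ej] : exists x, j = (fsize c).*2 + x by exists (j - (fsize c).*2); lia.
have : x < (fsize (Node r Emp)).*2 by move: lt_j; rewrite ej /=; lia.
rewrite {}ej addKn {j lt_j c_j}.
case/nodeP => [|y y_r||//].
- by rewrite addn0 ifF ?mate_close /=; lia.
- have -> : ((fsize c).*2 + y.+1).+1 = (fsize c).*2.+2 + y by lia.
  by rewrite ifF ?mate_out /=; lia.
- by rewrite ifT /=; lia.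
Qed.

Lemma adj_rot1_imp F G : adj F G -> adj (rot1 F) (rot1 G).
Proof.
case/adjP=> sz disj nc; set n := (fsize F).*2 in disj nc.
have mF j : j < n -> mate F j < n /\ mate F (mate F j) = j.
  by move=> lt_j; rewrite mate_lt ?mateK.
have mG j : j < n -> mate G j < n /\ mate G (mate G j) = j.
  by move=> lt_j; rewrite /n sz mate_lt ?mateK // -sz.
apply/adjP; rewrite !fsize_rot1 -/n; split=> // [j lt_j|i j lt_j].
  rewrite !mate_rot1 -?sz -/n //=.
  have := disj (if j.+1 == n then 0 else j.+1); case: ifP => e lt; have {}lt := lt ltac:(lia).
    by have [] := mF 0 ltac:(lia); have [] := mG 0 ltac:(lia); do 2!case: ifP; lia.
  by have [] := mF j.+1 ltac:(lia); have [] := mG j.+1 ltac:(lia); do 2!case: ifP; lia.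
move=> lt_ij; have lt_i : i < n by lia.
have lt_pi : mate (rot1 F) i < n by rewrite /n -fsize_rot1 mate_lt // fsize_rot1.
have ei : (i.+1 == n) = false by lia.
have ej : (j.+1 == n) = false by lia.
move: lt_ij lt_pi; rewrite !mate_rot1 -?sz -/n //= ei ej.
have [lt_q Kq] := mG j.+1 ltac:(lia); have [lt_p Kp] := mF i.+1 ltac:(lia).
(* The edge joining [0] and [i.+1] becomes the edge from [i] to the last point, so its inside and
   outside are exchanged; the hypothesis is applied to the other endpoint of the [G]-edge. *)
case: (@eqP _ (mate F i.+1) 0) => [p0|p_i] lt_ij lt_pi.
  case: ifP => q0; first lia.
  by rewrite p0 in Kp; have := nc 0 (mate G j.+1) lt_q; rewrite Kp Kq; lia.
by have := nc i.+1 j.+1; case: ifP; lia.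
Qed.

Lemma adj_rot1 F G : adj (rot1 F) (rot1 G) = adj F G.
Proof.
apply/idP/idP; last exact: adj_rot1_imp.
case/adjP; rewrite !fsize_rot1 => sz; set n := (fsize F).*2 => disj nc.
have mF j : j < n -> mate F j < n /\ mate F (mate F j) = j.
  by move=> lt_j; rewrite mate_lt ?mateK.
have mG j : j < n -> mate G j < n /\ mate G (mate G j) = j.
  by move=> lt_j; rewrite /n sz mate_lt ?mateK // -sz.
apply/adjP; rewrite -/n; split=> // [j lt_j|i j lt_j lt_ij].
  apply/negP=> /eqP eq_m; have [j0|j0] := posnP j.
    rewrite j0 in eq_m; have en : n.-1.+1 == n by lia.
    by have := disj n.-1; rewrite !mate_rot1 -?sz -/n ?en /= ?eq_m ?eqxx; lia.
  have ej : (j == n) = false by lia.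
  by have := disj j.-1; rewrite !mate_rot1 -?sz -/n ?prednK ?ej //= ?eq_m ?eqxx; lia.
have lt_i : i < n by lia.
have [lt_pi Kp] := mF i lt_i; have [lt_q Kq] := mG j lt_j.
have [i0|i_gt0] := posnP i.
  apply/andP; split; first lia.
  rewrite leqNgt; apply/negP => lt_pq; rewrite i0 in lt_ij lt_pi Kp lt_pq.
  have := nc (mate F 0).-1 (mate G j).-1.
  have e1 : (mate F 0 == n) = false by lia.
  have e2 : (mate G j == n) = false by lia.
  rewrite !mate_rot1 -?sz -/n; try lia.
  rewrite /= !prednK ?e1 ?e2 ?Kp ?Kq /=; try lia.
  by case: ifP; lia.
have e1 : (i == n) = false by lia.
have e2 : (j == n) = false by lia.
have := nc i.-1 j.-1; rewrite !mate_rot1 -?sz -/n; try lia.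
rewrite /= !prednK ?e1 ?e2; try lia.
by do 2!case: ifP; lia.
Qed.

Lemma adj_unrot1 F G : adj (unrot1 F) (unrot1 G) = adj F G.
Proof. by rewrite -adj_rot1 !unrot1K. Qed.

Lemma rot1_ins i f G : i < (fsize G).*2 -> rot1 (ins i.+1 f G) = ins i f (rot1 G).
Proof.
case: G => // c r lt_i /=; case: ifP => i_c /=; first by rewrite ins_catl.
have -> : i = (fsize c).*2 + (i - (fsize c).*2) by lia.
rewrite ins_catr /= ifF; last lia.
rewrite ifT; last by move: lt_i => /=; lia.
by congr (fcat _ (Node (ins _ _ _) _)); lia.
Qed.

(** Up to rotation every inserted run may be assumed to stand at the front. *)
Lemma iter_rot1_ins i f G : i <= (fsize G).*2 ->
  iter i rot1 (ins i f G) = fcat f (iter i rot1 G).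
Proof.
elim: i G => [|i IHi] G le_i; first exact: ins0.
by rewrite !iterSr rot1_ins // IHi // fsize_rot1; lia.
Qed.

Lemma fsize_iter_rot1 r F : fsize (iter r rot1 F) = fsize F.
Proof. by elim: r => //= r <-; rewrite fsize_rot1. Qed.

Lemma adj_iter_rot1 r F G : adj (iter r rot1 F) (iter r rot1 G) = adj F G.
Proof. by elim: r => //= r <-; rewrite adj_rot1. Qed.

Lemma stable_rot1 F i m : i + m.*2 < (fsize F).*2 -> stable (rot1 F) i m = stable F i.+1 m.
Proof.
move=> le_i; apply/stableP/stableP => h j j_in.
  have ej : (j == (fsize F).*2) = false by lia.
  have := h j.-1; rewrite mate_rot1 /=; last lia.
  by rewrite prednK ?ej; [case: ifP|]; lia.
have ej : (j.+1 == (fsize F).*2) = false by lia.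
have lt_j : j < (fsize F).*2 by lia.
by have := h j.+1; rewrite mate_rot1 //= ej; case: ifP; lia.
Qed.

Inductive conn F : forest -> Prop :=
  | Conn0 : conn F F
  | ConnS G H of conn F G & adj G H : conn F H.

Lemma conn1 F G : adj F G -> conn F G.
Proof. exact/ConnS/Conn0. Qed.

Lemma conn_trans F G H : conn F G -> conn G H -> conn F H.
Proof. by move=> cFG; elim=> // {}G' {}H _ cFG' /(ConnS cFG'). Qed.

Lemma conn_sym F G : conn F G -> conn G F.
Proof.
elim=> [|{}G H _ cGF adjGH]; first exact: Conn0.
by apply: conn_trans cGF; apply/conn1/adj_sym.
Qed.

Lemma conn_size F G : conn F G -> fsize F = fsize G.
Proof. by elim=> // {}G H _ -> /adj_size. Qed.

Lemma conn_map (h : forest -> forest) F G :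
  (forall X Y, adj X Y -> adj (h X) (h Y)) -> conn F G -> conn (h F) (h G).
Proof. by move=> hadj; elim=> [|{}G H _ cFG /hadj]; [apply: Conn0|apply: ConnS]. Qed.

Lemma conn_rot1 F G : conn (rot1 F) (rot1 G) <-> conn F G.
Proof.
split; last by apply: conn_map => X Y; rewrite adj_rot1.
by move/(@conn_map unrot1); rewrite !rot1K; apply=> X Y; rewrite adj_unrot1.
Qed.

Definition order_ge F m :=
  exists us, [/\ uniq us, size us = m & {in us, forall G, conn F G}].

Lemma order_ge_conn F G m : conn F G -> order_ge G m -> order_ge F m.
Proof.
move=> cFG [us [Uus szus cus]]; exists us; split=> // H /cus.
exact: conn_trans.
Qed.

Lemma order_ge_rot1 F m : order_ge (rot1 F) m -> order_ge F m.
Proof.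
case=> us [Uus szus cus]; exists (map unrot1 us); rewrite size_map.
rewrite map_inj_uniq //; last exact: can_inj unrot1K.
split=> // _ /mapP[G /cus cG ->].
by apply/conn_rot1; rewrite unrot1K.
Qed.

(** * The lower bound on the order *)

Lemma adj_cat f f' G G' : adj f f' -> adj G G' -> adj (fcat f G) (fcat f' G').
Proof. by move=> adjf adjG; rewrite -!ins0 adj_ins. Qed.

Lemma adj_catE f f' G G' : fsize f = fsize f' ->
  adj (fcat f G) (fcat f' G') -> adj f f' /\ adj G G'.
Proof. by move=> szf; rewrite -!ins0; apply: adj_insE. Qed.

Lemma stable_cat f G : stable (fcat f G) 0 (fsize f).
Proof. by rewrite -ins0; apply: stable_ins. Qed.

(** Each step on a path from [M] is accompanied by a flip of the four new points, so their state
    alternates with the length of the path. *)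
Lemma conn_lift M X : conn M X ->
  exists2 Y, conn (fcat antiblock M) Y & Y = fcat antiblock X \/ Y = fcat block X.
Proof.
elim=> [|G H _ [Y cY eY] adjGH]; first by exists (fcat antiblock M); [apply: Conn0|left].
case: eY cY => -> cY.
  by exists (fcat block H); [apply: ConnS cY (adj_cat _ adjGH)|right].
by exists (fcat antiblock H); [apply: ConnS cY (adj_cat _ adjGH)|left].
Qed.

(** A common left inverse of prefixing a block and prefixing an antiblock: lifts of distinct
    vertices are distinct whichever prefix they carry. *)
Definition behead2 H :=
  match H with
  | Node (Node Emp Emp) G | Node Emp (Node Emp G) => G
  | _ => Emp
  end.

(** The lifts match the first four points among themselves and the members of [zs] do not, so the
    two lists are disjoint. *)
Lemma order_ge_lift M m zs : order_ge M m -> uniq zs ->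
    {in zs, forall z, conn (fcat antiblock M) z /\ ~~ stable z 0 2} ->
  order_ge (fcat antiblock M) (m + size zs).
Proof.
case=> us [Uus <- cus] Uzs czs.
have [vs [evs cvs]] : exists vs, map behead2 vs = us /\
    {in vs, forall Y, conn (fcat antiblock M) Y /\ stable Y 0 2}.
  elim: us {Uus} cus => [|X us IHus] cus; first by exists [::].
  have [|vs [evs cvs]] := IHus; first by move=> Z Zus; apply: cus; rewrite inE Zus orbT.
  have [|Y cY eY] := @conn_lift M X; first by apply: cus; rewrite mem_head.
  exists (Y :: vs); split; first by rewrite /= evs; case: eY => ->.
  move=> Z; rewrite inE => /predU1P[->|/cvs//]; split=> //.
  by case: eY => ->; apply: stable_cat.
exists (vs ++ zs); split.
- rewrite cat_uniq Uzs andbT; apply/andP; split.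
    by apply: (map_uniq (f := behead2)); rewrite evs.
  by apply/hasPn => z /czs[_]; apply: contra => /cvs[].
- by rewrite size_cat -evs size_map.
- by move=> z; rewrite mem_cat => /orP[/cvs[]|/czs[]].
Qed.

Lemma ins_neq i f f' G G' : i <= (fsize G).*2 -> fsize f = fsize f' ->
  G != G' -> ins i f G != ins i f' G'.
Proof. by move=> le_i szf; apply: contra_neq => /(ins_inj le_i szf)[]. Qed.

(** Blocks and antiblocks are cut out of [G], to be flipped on their own, until a single edge
    remains; then [()()()] has the neighbour [(()())]. *)
Lemma unstable_neighbor G : odd (fsize G) ->
  exists2 z, adj (fcat antiblock G) z & ~~ stable z 0 2.
Proof.
have [n] := ubnP (fsize G); elim: n G => // n IHn G le_n oG.
have [G1|G1] := eqVneq (fsize G) 1; first by exists ring3'; rewrite ?(fsize1 G1).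
have [i [b [H [le_i /flip2[b' [_ szb adjb]] eG]]]] : exists i b H,
  [/\ i <= (fsize H).*2, b = block \/ b = antiblock & G = ins i b H] by apply: factor2; lia.
have szG : fsize G = (fsize H).+2 by rewrite eG fsize_ins szb.
have [||z adjz unz] := IHn H; try lia.
have le_i4 : 4 + i <= (fsize (fcat antiblock H)).*2 by rewrite /=; lia.
exists (ins (4 + i) b' z).
  rewrite eG -[fcat antiblock (ins i b H)]/(fcat antiblock _) -(ins_catr i b antiblock).
  exact: adj_ins.
by rewrite stable_ins_front // -(adj_size adjz).
Qed.

(** A block at the front becomes an antiblock after one step, which replaces the rest by a
    neighbour; by symmetry that rest is again not isolated. *)
Lemma rot1_block_factor i b G : i <= (fsize G).*2 -> b = block \/ b = antiblock ->
  (exists X, adj G X) ->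
  exists r M, conn (iter r rot1 (ins i b G)) (fcat antiblock M) /\ exists X, adj M X.
Proof.
move=> le_i bP [X adjX]; exists i; rewrite iter_rot1_ins //.
case: bP => ->.
  exists (iter i rot1 X); split; last by exists (iter i rot1 G); rewrite adj_iter_rot1 adj_sym.
  by apply/conn1/adj_cat; rewrite ?adj_iter_rot1.
exists (iter i rot1 G); split; first exact: Conn0.
by exists (iter i rot1 X); rewrite adj_iter_rot1.
Qed.

(** If [F] contains a block, the rest inherits a neighbour. Otherwise it contains a ring of three
    edges, and a run of two edges is sought outside the ring. *)
Lemma rot1_antiblock F : odd (fsize F) -> 3 < fsize F -> (exists X, adj F X) ->
  exists r M, conn (iter r rot1 F) (fcat antiblock M) /\ exists X, adj M X.
Proof.
move=> oF F3 exF.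
have [i [b [G [le_i bP eF]]]] := factor3 (ltnW F3).
have [eb|b_ring] := eqVneq b block.
  have adjG : exists X, adj G X.
    by case: exF => X; rewrite eF eb => /(adj_block le_i)[G' _]; exists G'.
  by rewrite eF; apply: rot1_block_factor adjG => //; left.
have [b' szb adjb] : exists2 b', fsize b = 3 & adj b b'.
  by move: bP; rewrite !inE (negPf b_ring) /= => /orP[]/eqP->; [exists ring3|exists ring3'].
have szF : fsize F = 3 + fsize G by rewrite eF fsize_ins szb.
(* With the ring rotated to the front, the remainder has positive even size; after removing [c], the
   ring and the even forest [H] are still flippable. *)
have [|j [c [H [le_j cP eG]]]] := @factor2 (iter i rot1 G); first by rewrite fsize_iter_rot1; lia.
have szc : fsize c = 2 by case: cP => ->.
have szG : fsize G = 2 + fsize H by rewrite -(fsize_iter_rot1 i) eG fsize_ins szc.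
have [|X adjX] := @adj_even H; first lia.
have [||r [M [cM exM]]] := @rot1_block_factor ((fsize b).*2 + j) c (fcat b H) _ cP.
- by rewrite fsize_cat; lia.
- by exists (fcat b' X); apply: adj_cat.
exists (r + i), M; split=> //.
by rewrite iterD eF iter_rot1_ins // eG -ins_catr.
Qed.

(** * Components of minimal order contain a caterpillar *)

(* [Node c Emp] is a rooted caterpillar all of whose inner vertices have two
   children. *)
Fixpoint chain c :=
  match c with
  | Emp => true
  | Node a (Node b Emp) =>
      if a is Emp then chain b else if b is Emp then chain a else false
  | _ => false
  end.

(* The dual tree is a caterpillar with all inner vertices of degree 3; the two
   cases correspond to the root region being a leaf or an inner vertex. *)
Definition caterpillar F :=
  match F with
  | Node u Emp => if u is Node a (Node b Emp) then chain a && chain b else false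
  | Node a (Node b (Node c Emp)) =>
      [&& chain a, chain b, chain c & Emp \in [:: a; b; c]]
  | _ => false
  end.

Variant chain_spec : forest -> Prop :=
  | ChainEmp : chain_spec Emp
  | ChainNode a b of chain a & chain b & a = Emp \/ b = Emp :
      chain_spec (Node a (Node b Emp)).

Lemma chainP c : chain c -> chain_spec c.
Proof.
case: c => [|[|a1 a2] [|[|b1 b2] []]] //= ch; try exact: ChainEmp;
  by apply: ChainNode => //; auto.
Qed.

Lemma chain_Node a b : chain a -> chain b -> a = Emp \/ b = Emp ->
  chain (Node a (Node b Emp)).
Proof. by move=> cha chb [->|->] //; case: a cha. Qed.

Lemma chain_even c : chain c -> ~~ odd (fsize c).
Proof.
have [n] := ubnP (fsize c); elim: n c => // n IHn c le_n.
move=> chc; case: (chainP chc) le_n => [|a b cha chb _] //= le_n.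
by have := IHn a; have := IHn b; rewrite cha chb /=; lia.
Qed.

Lemma adj_chain c : chain c -> exists X, adj c X.
Proof. by move/chain_even/adj_even. Qed.

(** Compares two forests built by the same nested insertions, reducing to adjacency of the inserted
    pieces and of the base. *)
Ltac adj_holes :=
  repeat (apply: adj_ins; [by rewrite ?fsize_ins /=; lia|by []|]); by [].

Lemma adj_chain_tree c : chain c -> c != Emp -> exists X, adj (Node c Emp) X.
Proof.
move=> chc; case: (chainP chc) => // a b /adj_chain[a' adja] /adj_chain[b' adjb] _ _.
(* The outer edge and its two children form a [ring3'] with [a] and [b] in its gaps; the ring and
   both fillings are flipped. *)
exists (ins 2 a' (ins 4 b' ring3)).
by rewrite -[Node _ _]/(ins 2 a (ins 4 b ring3')); adj_holes.
Qed.

(** Five edges around one region, together with two neighbours that join the first point to a point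
    beyond the first four. *)
Notation ring5 := (fcat antiblock ring3).
Notation ring5' := (Node (fcat antiblock antiblock) Emp).
Notation ring5'' := (Node antiblock block).

(** Two vertices that do not arise by lifting: one more than the minimal order allows. *)
Definition unstable_pair F := exists z1 z2,
  [/\ z1 != z2, conn F z1 /\ ~~ stable z1 0 2 & conn F z2 /\ ~~ stable z2 0 2].

Lemma two_unstable (h : forest -> forest) F :
    (forall X, fsize X = 5 -> stable (h X) 0 2 = stable X 0 2) ->
    (forall X Y, fsize X = 5 -> fsize Y = 5 -> X != Y -> h X != h Y) ->
    (forall X, adj ring5 X -> conn F (h X)) ->
  unstable_pair F.
Proof.
move=> sth injh connh; exists (h ring5'), (h ring5''); rewrite injh //.
by split=> //; (split; [apply: connh|rewrite sth]).
Qed.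

(** The two new edges raise the degree of the root region by two. A leaf becomes a vertex of degree
    3, and only its position can spoil the caterpillar; a vertex of degree 3 becomes a [ring5]. *)
Lemma caterpillar_antiblock N : caterpillar N ->
  caterpillar (fcat antiblock N) \/ unstable_pair (fcat antiblock N).
Proof.
case: N => [|u [|v [|w [|? ?]]]] //; first case: u => [|a [|b []]] //.
- move=> /andP[cha chb]; have [ab|/norP[a0 b0]] := boolP ((a == Emp) || (b == Emp)).
    left; rewrite /= !inE eqxx ?orbT /= !andbT.
    by apply: (@chain_Node a b) => //; case/orP: ab => /eqP->; auto.
  right; have [A adjA] := adj_chain_tree cha a0; have [B adjB] := adj_chain_tree chb b0.
  have [a' adja] := adj_chain cha; have [b' adjb] := adj_chain chb.
  have conn_ring P : adj (Node a (Node b Emp)) P ->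
      conn (fcat antiblock (Node (Node a (Node b Emp)) Emp)) (ins 5 P ring3').
    move=> adjP; apply: conn1; rewrite -[fcat _ _]/(ins 5 (Node a (Node b Emp)) ring3).
    exact: adj_ins.
  (* Both vertices turn the root edges into [ring3']. They differ in how the two edges around [a]
     and [b] are flipped: with each other, or each within its own tree. *)
  exists (ins 5 (ins 1 a' (ins 3 b' block)) ring3'), (ins 5 (fcat A B) ring3').
  have szA := adj_size adjA; have szB := adj_size adjB.
  have sza := adj_size adja; have szb := adj_size adjb.
  rewrite !stable_ins_front //; split; first last.
  - by split=> //; apply: conn_ring; apply: (adj_cat adjA adjB).
  - split=> //; apply: conn_ring; rewrite -[Node _ _]/(ins 1 a (ins 3 b antiblock)).
    by adj_holes.
  apply/eqP=> /ins_inj[//||/= eAB _].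
    by rewrite !fsize_ins fsize_cat -szA -szB -sza -szb /=; lia.
  by move: eAB szA szB; case: A {adjA} => [|x y] //= [_]; case: B {adjB} y => [|? ?] [].
- rename u into a, v into b, w into c.
case/and4P=> /adj_chain[a' adja] /adj_chain[b' adjb] /adj_chain[c' adjc] _; right.
have sza := adj_size adja; have szb := adj_size adjb; have szc := adj_size adjc.
pose h X := ins 5 a' (ins 7 b' (ins 9 c' X)).
have connh X : adj ring5 X -> conn (fcat antiblock (Node a (Node b (Node c Emp)))) (h X).
  move=> adjX; apply: conn1.
  rewrite -[fcat _ _]/(ins 5 a (ins 7 b (ins 9 c ring5))).
  by adj_holes.
apply: (@two_unstable h) => // [X szX|X Y szX szY].
  by rewrite !stable_ins_front // ?fsize_ins ?szX //; lia.
by move=> neq; rewrite !ins_neq // ?fsize_ins ?szX //; lia.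
Qed.

(** One step turns the ten base points into [ring5], a second one into [ring5'] or [ring5'']. Gaps
    from 4 on keep the first four points in place, and even fillings can always be flipped along. *)
Lemma unstable_ring i a j b l c :
    4 <= i <= 10 -> 4 <= j <= 10 -> 4 <= l <= 10 ->
    ~~ odd (fsize a) -> ~~ odd (fsize b) -> ~~ odd (fsize c) ->
  unstable_pair (ins i a (ins j b (ins l c (fcat block ring3')))).
Proof.
move=> hi hj hl /adj_even[a' adja] /adj_even[b' adjb] /adj_even[c' adjc].
pose h X := ins i a (ins j b (ins l c X)).
have adjh X : adj ring5 X -> adj (ins i a' (ins j b' (ins l c' ring5))) (h X).
  move=> adjX; do 3!(apply: adj_ins; [by rewrite ?fsize_ins /=; lia|exact: adj_sym|]).
  exact: adjX.
apply: (@two_unstable h) => // [X szX|X Y szX szY|X adjX].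
- by rewrite !stable_ins_front // ?fsize_ins ?szX //; lia.
- by move=> neq; rewrite !ins_neq // ?fsize_ins ?szX //; lia.
- by apply: ConnS (adjh _ adjX); apply/conn1/adj_sym/adjh.
Qed.

(* Here the block sits between the two leaves of an end of the caterpillar. *)
Lemma unstable_middle b : chain b -> b != Emp ->
  unstable_pair (fcat block (Node Emp (Node b (Node Emp Emp)))).
Proof.
move=> chb b0; have [b' adjb] := adj_chain chb; have [B adjB] := adj_chain_tree chb b0.
pose z1 := ins 7 b (Node (Node Emp (Node Emp block)) Emp).
pose z2 := ins 6 B (Node block leaf).
have conn1z : conn (fcat block (Node Emp (Node b leaf))) z1.
  apply: (@ConnS _ (ins 7 b' (fcat antiblock ring3'))).
    by apply: conn1; rewrite -[fcat _ _]/(ins 7 b (fcat block ring3)); adj_holes.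
  by move: adjb => /adj_sym adjb; rewrite /z1; adj_holes.
have adj12 : adj z1 z2.
  (* The edge around [b] is now treated as a tree of its own, which has the neighbour [B] because
     [b] is not empty. *)
  by rewrite -[z1]/(ins 6 (Node b Emp) (Node ring3 Emp)) /z2; adj_holes.
exists z1, z2; rewrite /z1 /z2 !stable_ins_front // -/z1 -/z2; split.
- by apply/eqP => e; move: adj12; rewrite -e adj_irr.
- by split.
- by split=> //; apply: ConnS adj12.
Qed.

Lemma unstable_pair_conn F G : conn F G -> unstable_pair G -> unstable_pair F.
Proof.
move=> cFG [z1 [z2 [neq [c1 u1] [c2 u2]]]]; exists z1, z2.
by split=> //; split=> //; apply: conn_trans cFG _.
Qed.

(** Any inner vertex next to the root, except one inside the middle tree, supplies a [ring3'] for
    [unstable_ring]. What remains is a middle tree between two leaves. *)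
Lemma caterpillar_block N : caterpillar N ->
  (exists2 N', conn (fcat block N) N' & caterpillar N') \/ unstable_pair (fcat block N).
Proof.
case: N => [|u [|v [|w [|? ?]]]] //; first case: u => [|a [|b []]] //.
- move=> /andP[/chain_even eva /chain_even evb]; right.
  have := @unstable_ring 6 a 8 b 10 Emp isT isT isT eva evb isT.
  by rewrite ins_nil.
rename u into a, v into b, w into c.
case/and4P=> cha chb chc _; have eva := chain_even cha.
have evb := chain_even chb; have evc := chain_even chc.
case: (chainP cha) eva => [_|a1 a2 /chain_even ev1 /chain_even ev2 _ _]; last first.
  right; apply: (@unstable_ring 6 a1 8 a2 10 (Node b (Node c Emp))) => //=; lia.
case: (chainP chc) evc => [_|c1 c2 /chain_even ev1 /chain_even ev2 _ _]; last first.
  right; apply: (@unstable_ring 4 (Node Emp (Node b Emp)) 6 c1 8 c2) => //=; lia.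
have [->|b0] := eqVneq b Emp.
  by left; exists (fcat antiblock ring3'); first exact: conn1.
by right; apply: unstable_middle.
Qed.

Lemma caterpillar_rot1 F : caterpillar (rot1 F) = caterpillar F.
Proof.
have chE a b : chain (Node a (Node b Emp)) = [&& chain a, chain b & Emp \in [:: a; b]].
  by case: a => [|? ?]; case: b => [|? ?] //=; rewrite ?andbT ?andbF.
have neqE a b : (Emp == Node a b) = false by apply/eqP.
case: F => // [[|x [|y [|p q]]] r] //.
- case: r => [|u [|v [|? ?]]] //.
  by rewrite [rot1 _]/= /caterpillar !inE eqxx andbT.
- by case: r => [|u [|v [|? ?]]] //=; case: x => [|? [|? []]].
- case: r => [|u [|v [|? ?]]] //; rewrite [rot1 _]/= /caterpillar.
  + by rewrite !inE eqxx !orbT /= andbT.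
  + by rewrite [chain (Node u Emp)]/= !andbF.
  + rewrite !chE !inE !neqE; case: (chain x); case: (chain y);
    case: (chain u); case: (chain v) => //=;
    by case: (_ == x); case: (_ == y); case: (_ == u); case: (_ == v).
  + by case: u => [|? ?]; rewrite ?andbF.
- by case: r => [|u [|v [|? ?]]] //=; case: q.
Qed.

(** The bound and the case of near equality are proved by one induction, since the second part needs
    the same lift together with the caterpillar in the smaller component. *)
Lemma order_ge_component F : odd (fsize F) -> 1 < fsize F -> (exists X, adj F X) ->
  order_ge F (fsize F)./2.+1 /\
  (order_ge F (fsize F)./2.+2 \/ exists2 N, conn F N & caterpillar N).
Proof.
have [n] := ubnP (fsize F); elim: n F => // n IHn F le_n oF F1 exF.
have [F3|F3] := leqP (fsize F) 3.
  have szF : fsize F = 3 by lia.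
  have [X adjX] := exF; split.
    exists [:: F; X]; rewrite szF /= inE andbT; split=> //.
      by apply/eqP => e; move: adjX; rewrite -e adj_irr // szF.
    by move=> Y; rewrite !inE => /orP[]/eqP->; [apply: Conn0|apply: conn1].
  right; exists F; first exact: Conn0.
  by have [->|->] := adj_fsize3 szF adjX.
have [r [M [cM exM]]] := rot1_antiblock oF F3 exF.
have szM : fsize F = (fsize M).+2.
  by rewrite -(fsize_iter_rot1 r) (conn_size cM).
have [||||geM eqM] := IHn M => //; try lia.
have [z adjz unz] := @unstable_neighbor M ltac:(lia).
have back m : order_ge (fcat antiblock M) m -> order_ge F m.
  move=> /(order_ge_conn cM); elim: r {cM} => //= r IHr /order_ge_rot1; exact: IHr.
have ge_zs m zs : order_ge M m -> uniq zs ->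
    {in zs, forall z, conn (fcat antiblock M) z /\ ~~ stable z 0 2} ->
  order_ge F (m + size zs).
  by move=> geMm Uzs czs; apply/back/order_ge_lift.
have z1P : {in [:: z], forall z, conn (fcat antiblock M) z /\ ~~ stable z 0 2}.
  by move=> y; rewrite inE => /eqP->; split=> //; apply: conn1.
have -> : (fsize F)./2 = (fsize M)./2.+1 by lia.
have {}ge1 m : order_ge M m -> order_ge F m.+1.
  by move=> geMm; rewrite -addn1; apply: (ge_zs m [:: z]).
split; first exact: ge1.
case: eqM => [/ge1|[N cN catN]]; first by left.
(* The parity of the path to [N] is unknown, so [N] may reappear behind a block or behind an
   antiblock. *)
have [Y cY eY] := conn_lift cN.
have [[N' cN' catN']|up] : (exists2 N', conn Y N' & caterpillar N') \/ unstable_pair Y.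
  case: eY => ->; last exact: caterpillar_block.
  case: (caterpillar_antiblock catN) => [catY|]; last by right.
  by left; exists (fcat antiblock N); first exact: Conn0.
  right; have: conn (iter r rot1 F) N' by apply/(conn_trans cM)/(conn_trans cY).
  (* The caterpillar found in the rotated component is rotated back. *)
  elim: r N' catN' {cM cN'} => [|r IHr] N' catN' /=; first by exists N'.
  rewrite -(unrot1K N') => /conn_rot1/IHr; apply.
  by rewrite -caterpillar_rot1 unrot1K.
have [z1 [z2 [neq [c1 u1] [c2 u2]]]] := unstable_pair_conn cY up.
left; rewrite -addn2; apply: (ge_zs _ [:: z1; z2]) => //; first by rewrite /= inE neq.
by move=> y; rewrite !inE => /orP[]/eqP->.
Qed.

(** * Components of caterpillars are stars *)

(** An edge encloses whole edges only, so its endpoints have opposite parity. *)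
Lemma mate_odd F i : i < (fsize F).*2 -> odd (mate F i) = ~~ odd i.
Proof.
elim: F i => // c IHc r IHr i lt_i; case: (nodeP lt_i) => [|j /IHc||j /IHr] //=; lia.
Qed.

Lemma adj_ring3 H : adj ring3 H -> H = ring3'.
Proof.
move=> adjH; have [|//] := adj_fsize3 (esym (adj_size adjH)) (adj_sym adjH).
by move=> eH; move: adjH; rewrite eH adj_irr.
Qed.

Lemma adj_ring3' H : adj ring3' H -> H = ring3.
Proof.
move=> adjH; have [//|] := adj_fsize3 (esym (adj_size adjH)) (adj_sym adjH).
by move=> eH; move: adjH; rewrite eH adj_irr.
Qed.

Definition unique_neighbor F P := adj F P /\ forall H, adj F H -> H = P.

Lemma unique_neighbor_block i F P : i <= (fsize F).*2 ->
  unique_neighbor F P -> unique_neighbor (ins i block F) (ins i antiblock P).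
Proof.
move=> le_i [adjP uniqP]; split; first exact: adj_ins.
by move=> H /(adj_block le_i)[G -> /uniqP->].
Qed.

Lemma unique_neighbor_rot1 F P : unique_neighbor F P -> unique_neighbor (rot1 F) (rot1 P).
Proof.
case=> adjP uniqP; split; first by rewrite adj_rot1.
by move=> H; rewrite -[H]unrot1K adj_rot1 => /uniqP->.
Qed.

Lemma unique_neighbor_unrot1 F P : unique_neighbor (rot1 F) P -> unique_neighbor F (unrot1 P).
Proof.
case=> adjP uniqP; split; first by rewrite -adj_rot1 unrot1K.
by move=> H adjH; rewrite -[H]rot1K (uniqP (rot1 H)) // adj_rot1.
Qed.

(** Rotating by one point turns the leaf edge of the top vertex and its sibling edge into a block
    beside a shorter chain: [()(b)] comes from [(())b], and [(a)()] goes to [a(())]. *)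
Lemma unique_neighbor_chain c : chain c -> exists P, unique_neighbor c P.
Proof.
have [n] := ubnP (fsize c); elim: n c => // n IHn c le_n chc.
case: (chainP chc) le_n => [_|a b cha chb ab le_n].
  by exists Emp; split=> // H /adj_size/esym/fsize0.
case: ab => e; subst.
  have [||P uniqP] := IHn b => //; first by move: le_n => /=; lia.
  exists (rot1 (ins 0 antiblock P)); rewrite -[Node _ _]/(rot1 (Node leaf b)).
  rewrite -[Node leaf b]/(fcat block b) -ins0.
  exact/unique_neighbor_rot1/unique_neighbor_block.
have [||P uniqP] := IHn a => //; first by move: le_n => /=; lia.
exists (unrot1 (ins (fsize a).*2 antiblock P)); apply: unique_neighbor_unrot1.
have -> : rot1 (Node a leaf) = ins (fsize a).*2 block a.
  by have := ins_catr 0 block a Emp; rewrite addn0 fcats0.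
exact: unique_neighbor_block.
Qed.

Lemma chain_antiblock c : chain c -> c <> Emp ->
  exists i d, [/\ i <= (fsize d).*2, chain d & c = ins i antiblock d].
Proof.
have [n] := ubnP (fsize c); elim: n c => // n IHn c le_n chc.
case: (chainP chc) le_n => [|a b cha chb ab] //= le_n _.
have [a0|a0] := eqVneq a Emp; first have [b0|/eqP b0] := eqVneq b Emp.
- by exists 0, Emp; rewrite a0 b0.
- have [|||i [d [le_i chd eb]]] := IHn b => //; first lia.
  exists (3 + i), (Node Emp (Node d Emp)); rewrite a0 eb /=; split=> //; first lia.
  by rewrite ifT //; lia.
have b0 : b = Emp by case: ab a0 => // ->.
have [|||i [d [le_i chd ea]]] := IHn a; [lia|by []|exact/eqP|].
exists i.+1, (Node d leaf); rewrite b0 ea; split=> [|| /=].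
- by rewrite /=; lia.
- by apply: chain_Node => //; right.
- by rewrite ifT //; lia.
Qed.

(** An antiblock of [c] is a block in [P], the unique neighbour of [c], and a block forces [H]
    there. Removing it shortens the chain until only [ring3] is left. *)
Lemma adj_ring3_chain c P H : chain c -> adj c P -> adj (fcat ring3 P) H -> H = fcat ring3' c.
Proof.
have [n] := ubnP (fsize c); elim: n c P H => // n IHn c P H le_n chc adjP.
have [c0|/eqP c0] := eqVneq c Emp.
  by have -> : P = Emp; [apply: fsize0; rewrite -(adj_size adjP) c0|rewrite c0; apply: adj_ring3].
have [i [d [le_i chd ec]]] := chain_antiblock chc c0.
have [Q adjQ] := adj_chain chd.
have [R [_ uniqR]] := unique_neighbor_chain chc.
have -> : P = ins i block Q.
  by rewrite (uniqR P) // (uniqR (ins i block Q)) // ec; apply: adj_ins.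
have szd := adj_size adjQ; rewrite -(ins_catr i block ring3).
move=> /adj_block[|G -> adjG]; first by rewrite fsize_cat /=; lia.
rewrite (IHn d Q G) //; first by rewrite ec -(ins_catr i antiblock ring3').
by move: le_n; rewrite ec fsize_ins /=; lia.
Qed.

(** The points 1 to 4 lie below the edge from 0 to 5, so their partners are among the first six
    points. If these six are not closed under [H], then 0 or 5 leaves, and parity also excludes the
    other one as a partner. *)
Lemma adj_cat_ring3' w H : adj (fcat ring3' w) H ->
  stable H 1 2 \/ exists2 P, H = fcat ring3 P & adj w P.
Proof.
move=> adjH; have /adjP[szH _ nc] := adjH.
have szw : fsize H = 3 + fsize w by rewrite -szH.
have mH j : j <= 5 -> odd (mate H j) = ~~ odd j /\ mate H (mate H j) = j.
  by move=> le_j; rewrite mate_odd ?mateK //; lia.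
have nc0 j : 0 < j < 5 -> mate H j <= 5 by have := nc 0 j; rewrite szH szw /=; lia.
have [stH|unst] := boolP (stable H 0 3).
  right; have [f [P [szf szP eH]]] := stable_split szw (leq0n _) stH.
  move: adjH; rewrite eH ins0 => /adj_catE[//|/adj_ring3'-> adjP]; by exists P.
left; apply/stableP => j j_in; have nc_j : mate H j <= 5 by apply: nc0; lia.
have [o K] := mH j ltac:(lia).
have parity x : 0 < x < 5 -> odd (mate H x) = ~~ odd x /\ mate H (mate H x) = x.
  by move=> lt_x; apply: mH; lia.
have mateE x y : 0 < x < 5 -> mate H x = y -> mate H y = x by move=> /parity[_ Kx] <-.
suff [m0 m5] : mate H j <> 0 /\ mate H j <> 5 by lia.
have [q0|q5] : 5 < mate H 0 \/ 5 < mate H 5.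
  case/allPn: unst => x; rewrite mem_iota => lt_x; have := nc0 x.
  case: (posnP x) => [->|x_gt0]; first by left; lia.
  by case: (ltnP x 5) => x5; [|have -> : x = 5 by lia]; lia.
(* Here 0 leaves. Were 5 matched to [j], which is then 2 or 4, the odd points 1 and 3 would compete
   for the remaining even one. *)
- split=> [e|e]; first by have := mateE j 0 j_in e; lia.
  have mate13 x : odd x -> 0 < x < 5 -> mate H 2 = x \/ mate H 4 = x.
    move=> ox lt_x; have [ox' _] := parity x lt_x; have n_x := nc0 x lt_x.
    have r0 := mateE x 0 lt_x; have r2 := mateE x 2 lt_x; have r4 := mateE x 4 lt_x; lia.
  have := mate13 1 isT isT; have := mate13 3 isT isT.
  have [ej|ej] : j = 2 \/ j = 4 by lia.
    by move: e; rewrite ej; lia.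
  by move: e; rewrite ej; lia.
- split=> [e|e]; last by have := mateE j 5 j_in e; lia.
  have mate24 x : ~~ odd x -> 0 < x < 5 -> mate H 1 = x \/ mate H 3 = x.
    move=> ox lt_x; have [ox' _] := parity x lt_x; have n_x := nc0 x lt_x.
    have r5 := mateE x 5 lt_x; have r1 := mateE x 1 lt_x; have r3 := mateE x 3 lt_x; lia.
  have := mate24 2 isT isT; have := mate24 4 isT isT.
  have [ej|ej] : j = 1 \/ j = 3 by lia.
    by move: e; rewrite ej; lia.
  by move: e; rewrite ej; lia.
Qed.

Definition star F := exists us, [/\ uniq us, size us = (fsize F)./2,
  forall G, adj F G = (G \in us) & forall G H, G \in us -> adj G H -> H = F].

Lemma star_rot1 F : star (rot1 F) -> star F.
Proof.
case=> us [Uus szus adjus uniqus]; exists (map unrot1 us).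
have inus G : (G \in map unrot1 us) = (rot1 G \in us).
  by rewrite -{1}[G]rot1K mem_map //; apply: can_inj unrot1K.
split=> [|| G | G H].
- by rewrite map_inj_uniq //; apply: can_inj unrot1K.
- by rewrite size_map szus fsize_rot1.
- by rewrite inus -adjus adj_rot1.
- rewrite inus => /uniqus uniqG adjG; apply: (can_inj rot1K).
  by apply: uniqG; rewrite adj_rot1.
Qed.

(** One rotation moves the root region across the first edge into [a]. Following a nonempty branch
    leads to an end of the caterpillar, a vertex with two leaves. *)
Lemma rot1_tail_chain a b c : chain a -> chain b -> chain c -> a != Emp ->
    b = Emp \/ c = Emp ->
  exists r v, [/\ chain v, v != Emp &
    iter r rot1 (Node a (Node b (Node c Emp))) = fcat antiblock (Node v Emp)].
Proof.
have [n] := ubnP (fsize a); elim: n a b c => // n IHn a b c le_n cha chb chc a0 bc.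
case: (chainP cha) a0 le_n => // x y chx chy xy _ le_n.
have [x0|x0] := eqVneq x Emp.
  have [y0|y0] := eqVneq y Emp.
    by exists 1, (Node b (Node c Emp)); rewrite x0 y0; split=> //; apply: chain_Node.
  have [||||||r [v [chv v0 er]]] := IHn y (Node b (Node c Emp)) Emp => //.
  - by move: le_n => /=; lia.
  - exact: chain_Node.
  - by right.
  (* After entering [a], two more rotations cross the leaf edge and return, which brings [y] to the
     front. *)
  by exists (r + 3), v; rewrite iterD x0.
have [||||||r [v [chv v0 er]]] := IHn x y (Node b (Node c Emp)) => //.
- by move: le_n => /=; lia.
- exact: chain_Node.
- by case: xy => [xE|->]; [rewrite xE in x0|left].
by exists (r + 1), v; rewrite iterD.
Qed.

Lemma caterpillar_odd F : caterpillar F -> odd (fsize F).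
Proof.
case: F => [|u [|v [|w [|? ?]]]] //; first case: u => [|a [|b []]] //=.
  by case/andP=> /chain_even ? /chain_even ?; lia.
by case/and4P=> /chain_even ? /chain_even ? /chain_even ? _ /=; lia.
Qed.

Lemma rot1_caterpillar F : caterpillar F -> 3 < fsize F ->
  exists r v, [/\ chain v, v != Emp & iter r rot1 F = fcat antiblock (Node v Emp)].
Proof.
have abc a b c : [&& chain a, chain b, chain c & Emp \in [:: a; b; c]] ->
    3 < fsize (Node a (Node b (Node c Emp))) ->
  exists r v, [/\ chain v, v != Emp &
    iter r rot1 (Node a (Node b (Node c Emp))) = fcat antiblock (Node v Emp)].
  case/and4P=> cha chb chc; rewrite !inE => emp sz.
  have [a0|a0] := eqVneq a Emp; last first.
    apply: rot1_tail_chain => //.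
    by case/or3P: emp => /eqP e; [rewrite -e eqxx in a0|left|right].
  subst a; have [b0|b0] := eqVneq b Emp; last first.
    have [|||||r [v [chv v0 er]]] := @rot1_tail_chain b c Emp => //; first by right.
    by exists (r + 2), v; rewrite iterD.
  subst b; have [|||||r [v [chv v0 er]]] := @rot1_tail_chain c Emp Emp => //.
  - by apply/eqP => c0; rewrite c0 in sz.
  - by left.
  by exists (r + 4), v; rewrite iterD.
case: F => [|u [|v [|w [|? ?]]]] //; last exact: abc.
case: u => [|a [|b []]] // /andP[cha chb] sz.
have [||r [v [chv v0 er]]] := abc a b Emp.
- by rewrite cha chb !inE eqxx !orbT.
- by move: sz => /=; lia.
by exists (r + 1), v; rewrite iterD.
Qed.

(** After rotation an end stands in front as [()()(v)]. The leaves of the smaller star at [(v)] lift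
    behind a block, and exactly one new leaf mixes the first four points with the others. *)
Lemma caterpillar_star F : caterpillar F -> star F.
Proof.
have [n] := ubnP (fsize F); elim: n F => // n IHn F le_n catF.
have oF := caterpillar_odd catF.
have [F3|F3] := leqP (fsize F) 3.
  have [->|->] : F = ring3 \/ F = ring3'.
    case: F oF F3 catF {le_n} => [|u [|v [|w [|? ?]]]] //=.
      case: u => [|a [|b []]] //= oF F3 _; right.
      by have [-> ->] : a = Emp /\ b = Emp by split; apply: fsize0; lia.
    move=> oF F3 _; left.
    by have [-> -> ->] : [/\ u = Emp, v = Emp & w = Emp] by split; apply: fsize0; lia.
  - exists [:: ring3']; split=> // [G|G H]; rewrite inE.
      by apply/idP/eqP => [/adj_ring3|->].
    by move=> /eqP-> /adj_ring3'.
  - exists [:: ring3]; split=> // [G|G H]; rewrite inE.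
      by apply/idP/eqP => [/adj_ring3'|->].
    by move=> /eqP-> /adj_ring3.
have [r [v [chv v0 eF]]] := rot1_caterpillar catF F3.
suff st : star (fcat antiblock (Node v Emp)).
  by move: st; rewrite -eF; elim: (r) => //= r' IHr /star_rot1.
have szF : fsize F = (fsize v).+3 by rewrite -(fsize_iter_rot1 r) eF /=; lia.
have [||us [Uus szus adjus uniqus]] := IHn (Node v Emp); first by rewrite /=; lia.
  by case: (chainP chv) v0 => // a b cha chb _ _; apply/andP.
have [P [adjP uniqP]] := unique_neighbor_chain chv.
(* The new leaf flips the three root edges as a ring and replaces [v] by its unique neighbour
   [P]. *)
exists (Node (fcat antiblock P) Emp :: map (fcat block) us).
have fcat_inj : injective (fcat block) by move=> x y [].
have rotP X : rot1 (fcat ring3 X) = Node (fcat antiblock X) Emp by [].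
have rotv : rot1 (fcat ring3' v) = fcat antiblock (Node v Emp) by [].
split.
- by rewrite /= map_inj_uniq // Uus andbT; apply/mapP => -[].
- by rewrite /= size_map szus /=; lia.
- move=> G; rewrite inE; apply/idP/orP => [adjG|[/eqP->|/mapP[X + ->]]].
  + have [stG|unstG] := boolP (stable G 0 2).
      right; have szG : fsize G = 2 + (fsize v).+1 by rewrite -(adj_size adjG) /=; lia.
      have [f [X [szf _ eG]]] := stable_split szG (leq0n _) stG.
      move: adjG; rewrite eG ins0 => /(@adj_catE antiblock _ _ _ (esym szf))[].
      by case: (fsize2 szf) => -> // _; rewrite adjus => Xus; apply: map_f.
    left; move: adjG; rewrite -rotv -[G]unrot1K adj_rot1 => adjU.
    (* The first alternative, rotated by one point, says that the first four points of [G] are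
       closed, which is excluded here. *)
    have [st|[Q eQ adjQ]] := adj_cat_ring3' adjU.
      move: unstG; rewrite -[G]unrot1K stable_rot1 ?st // -(adj_size adjU) /=; lia.
    by rewrite eQ (uniqP Q adjQ) rotP.
  + by rewrite -rotP -rotv adj_rot1; apply: (adj_cat (f := ring3') (f' := ring3)).
  + by rewrite -adjus => adjX; apply: (adj_cat (f := antiblock) (f' := block)).
- move=> G H; rewrite inE => /orP[/eqP->|/mapP[X + ->]].
    rewrite -rotP -rotv -[H]unrot1K adj_rot1 => adjU.
    by rewrite (adj_ring3_chain chv adjP adjU).
  move=> Xus; rewrite -ins0 => /adj_block[//|Y -> adjY].
  by rewrite ins0 (uniqus X Y).
Qed.

(** * Counting isolated matchings *)

(* An edge is reduced to the side on which it must be used in every disjoint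
   compatible matching.  The value 0 (1, 2) means that the number of edges of a
   forest available to the root region is always 0 (always 1, not forced). *)
Fixpoint forcing F :=
  if F is Node c r then
    if forcing c == 1 then forcing r
    else if (forcing c == 0) && (forcing r == 0) then 1 else 2
  else 0.

Lemma forcing_ins_block i G : forcing (ins i block G) = forcing G.
Proof. by elim: G i => // c IHc r IHr i /=; do 2!case: ifP => //=; rewrite (IHc, IHr). Qed.

Lemma forcing_parity F : forcing F <= 1 -> odd (fsize F) = (forcing F == 1).
Proof.
elim: F => //= c IHc r IHr; case: eqP => [c1 r_le|c1].
  by have := IHr r_le; rewrite c1 in IHc; have := IHc isT; lia.
case: andP => [[/eqP c0 /eqP r0]|//] _.
by rewrite c0 r0 in IHc IHr; have := IHc isT; have := IHr isT; lia.
Qed.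

(** By [forcing_parity] a small [c] of value 1 is a single edge, which gives a block, while small
    parts of value 0 are empty. *)
Lemma forcing_block F : forcing F <= 1 -> 1 < fsize F ->
  exists i G, i <= (fsize G).*2 /\ F = ins i block G.
Proof.
elim: F => //= c IHc r IHr leF szF.
have in_c : (exists i G, i <= (fsize G).*2 /\ c = ins i block G) ->
    exists i G, i <= (fsize G).*2 /\ Node c r = ins i block G.
  by case=> i [G [le_i ->]]; exists i.+1, (Node G r); split=> /=; rewrite ?ifT //; lia.
have in_r : (exists i G, i <= (fsize G).*2 /\ r = ins i block G) ->
    exists i G, i <= (fsize G).*2 /\ Node c r = ins i block G.
  case=> i [G [le_i ->]]; exists ((fsize c).*2.+2 + i), (Node c G).
  by split=> /=; rewrite ?ifF ?addKn //; lia.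
move: leF; case: eqP => [c1 le_r|c1].
  have [c2|c2] := leqP 2 (fsize c); first by apply/in_c/IHc; rewrite ?c1.
  have oc : odd (fsize c) by rewrite forcing_parity c1.
  by exists 0, r; rewrite ins0 (@fsize1 c) //; lia.
case: andP => // -[/eqP c0 /eqP r0] _.
have [c2|c2] := leqP 2 (fsize c); first by apply/in_c/IHc; rewrite ?c0.
have [r2|r2] := leqP 2 (fsize r); first by apply/in_r/IHr; rewrite ?r0.
have := @forcing_parity c; have := @forcing_parity r; rewrite c0 r0; lia.
Qed.

Lemma isolated_forcing F : forcing F = 1 -> forall G, ~~ adj F G.
Proof.
have [n] := ubnP (fsize F); elim: n F => // n IHn F le_n F1 G; apply/negP => adjG.
have oF : odd (fsize F) by rewrite forcing_parity F1.
have [szF|szF] := leqP (fsize F) 1.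
  have F_leaf : F = leaf by apply: fsize1; lia.
  have G_leaf : G = leaf by apply: fsize1; rewrite -(adj_size adjG); lia.
  by move: adjG; rewrite F_leaf G_leaf adj_irr.
have [|i [H [le_i eF]]] := forcing_block _ szF; first by rewrite F1.
move: adjG; rewrite eF => /(adj_block le_i)[K _]; apply/negP; apply: IHn.
  by move: le_n; rewrite eF fsize_ins /=; lia.
by move: F1; rewrite eF forcing_ins_block.
Qed.

(** Deleting a block preserves [forcing]; if there is a ring instead, the remainder is even and
    hence flippable. *)
Lemma forcing_neighbor F : odd (fsize F) -> forcing F != 1 -> exists G, adj F G.
Proof.
have [n] := ubnP (fsize F); elim: n F => // n IHn F le_n oF F1.
have [szF|szF] := leqP (fsize F) 2.
  by move: F1; rewrite (@fsize1 F) //; lia.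
have [i [b [G [le_i bP eF]]]] := factor3 szF.
have szbG : fsize F = fsize b + fsize G by rewrite eF fsize_ins.
have [eb|b_ring] := eqVneq b block.
  rewrite eb /= in szbG; have [|||X adjX] := IHn G; try lia.
    by move: F1; rewrite eF eb forcing_ins_block.
  by exists (ins i antiblock X); rewrite eF eb adj_ins.
have [b' szb adjb] : exists2 b', fsize b = 3 & adj b b'.
  by move: bP; rewrite !inE (negPf b_ring) /= => /orP[]/eqP->; [exists ring3|exists ring3'].
have [|X adjX] := @adj_even G; first by lia.
by exists (ins i b' X); rewrite eF adj_ins.
Qed.

Definition graft fs :=
  if fs is a :: b :: c :: d :: fs' then Node (fcat a (Node b c)) d :: fs' else [::].

(* Lists of [r] forests with [forcing] 0 and [2 n] edges in total; such a forest
   is empty or of the form [(a (b) c) d] with [a], [b], [c], [d] of this kind. *)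
Fixpoint unforced n : nat -> seq (seq forest) :=
  if n is n'.+1 then
    fix unforced_n r :=
      if r is r'.+1 then map (cons Emp) (unforced_n r') ++ map graft (unforced n' r'.+4)
      else [::]
  else fun r => [:: nseq r Emp].

Lemma unforcedS n r :
  unforced n.+1 r.+1 = map (cons Emp) (unforced n.+1 r) ++ map graft (unforced n r.+4).
Proof. by []. Qed.

(* Fuss-Catalan numbers: both sides satisfy Pascal-like recurrences. *)
Lemma size_unforced n r : size (unforced n r) * (4 * n + r) = r * 'C(4 * n + r, n).
Proof.
elim: n r => [|n IHn] r; first by rewrite bin0 /= mul1n muln1 add0n.
elim: r => [|r IHr]; first by rewrite mul0n.
rewrite unforcedS size_cat !size_map.
have := IHn r.+4; set N := 4 * n + r.+4 => eqn.
have eN : 4 * n.+1 + r = N by rewrite /N; lia.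
have eN1 : 4 * n.+1 + r.+1 = N.+1 by rewrite /N; lia.
rewrite eN in IHr; rewrite eN1 binS.
have Cn := mul_bin_left N n.
have nN : n <= N by rewrite /N; lia.
(* Both parts of the list have the same denominator [N] in their formulas; multiplying by it makes
   both induction hypotheses applicable. *)
apply/eqP; rewrite -(eqn_pmul2r (_ : 0 < N)); last by rewrite /N; lia.
have subN : N - n = 3 * n + r + 4 by rewrite /N; lia.
rewrite subN in Cn.
apply/eqP; rewrite mulnDl mulnDl.
rewrite [_ * N.+1 * N]mulnAC IHr [_ * N.+1 * N]mulnAC eqn.
move: Cn; set C0 := 'C(N, n); set C1 := 'C(N, n.+1) => Cn.
have Cn4 : 4 * n.+1 * C1 = 4 * (3 * n + r + 4) * C0 by rewrite -!mulnA Cn.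
have eNN : N = 4 * n.+1 + r by rewrite eN.
rewrite {1}eNN; nia.
Qed.

Lemma forcing_cat a X : forcing a = 0 -> forcing (fcat a X) = forcing X.
Proof. by elim: a => //= c _ r IHr; case: ifP => // _; case: ifP. Qed.

(** Value 1 means that exactly one root edge is available: the one around [b]. All root edges in [a]
    are used on their inner side. *)
Lemma forcing1_split F : forcing F = 1 -> exists a b c,
  [/\ forcing a = 0, forcing b = 0, forcing c = 0 & F = fcat a (Node b c)].
Proof.
elim: F => //= c _ r IHr; case: eqP => [c1 /IHr[a [b [d [a0 b0 d0 ->]]]]|c1].
  by exists (Node c a), b, d; rewrite /= c1.
by case: andP => // -[/eqP c0 /eqP r0] _; exists Emp, c, r.
Qed.

Lemma forcing_graft a b c : forcing a = 0 -> forcing b = 0 -> forcing c = 0 ->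
  forcing (fcat a (Node b c)) = 1.
Proof. by move=> a0 b0 c0; rewrite forcing_cat //= b0 c0. Qed.

Lemma graft_inj a b c a' b' c' : forcing a = 0 -> forcing b = 0 ->
    forcing a' = 0 -> forcing b' = 0 ->
  fcat a (Node b c) = fcat a' (Node b' c') -> [/\ a = a', b = b' & c = c'].
Proof.
move=> + b0 + b0'; elim: a a' => [|x _ a IHa] [|x' a'] //=.
- by move=> _ _ [-> ->].
- by case: eqP => [x1|_]; [|case: ifP] => // _ _ [eb]; rewrite -eb b0 in x1.
- by case: eqP => [x1|_]; [|case: ifP] => // _ _ [eb]; rewrite eb b0' in x1.
case: eqP => [_ a0|_]; last by case: ifP.
case: eqP => [_ a0'|_]; last by case: ifP.
by case=> -> /IHa[] // -> -> ->.
Qed.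

Definition unforced_spec n r fs :=
  [&& size fs == r, all (fun F => forcing F == 0) fs & sumn (map fsize fs) == n.*2].

Lemma mem_unforced n r fs : (fs \in unforced n r) = unforced_spec n r fs.
Proof.
rewrite /unforced_spec; elim: n r fs => [|n IHn] r fs.
  rewrite inE; apply/eqP/and3P => [->|[/eqP <- _]].
    rewrite size_nseq all_nseq orbT map_nseq; split=> //.
    by elim: r.
  by elim: fs => //= F fs IHfs; rewrite addn_eq0 => /andP[/eqP/fsize0-> /IHfs <-].
elim: r fs => [|r IHr] [|F fs] //=.
  rewrite mem_cat; apply/negP => /orP[]/mapP[] // gs.
  by rewrite IHn => /and3P[]; case: gs => [|? [|? [|? [|? ?]]]].
rewrite mem_cat; case: F => [|x d] /=.
  rewrite mem_map; last by move=> ? ? [].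
  rewrite IHr orbC; case: mapP => // -[gs] _.
  by case: gs => [|? [|? [|? [|? ?]]]].
rewrite orbC; case: (mapP (f := cons Emp)) => [[? _ //]|_]; rewrite orbF.
apply/mapP/and3P => [[gs]|[szfs /andP[x1 fs0] sumfs]].
  rewrite IHn; case: gs => [|a [|b [|c [|e gs]]]] //= /and3P[szgs].
  case/and5P=> /eqP a0 /eqP b0 /eqP c0 e0 gs0 sumgs [-> -> ->].
  rewrite forcing_graft // e0 gs0 fsize_cat /=; split=> //; lia.
have {x1} [x1 d0] : forcing x = 1 /\ forcing d = 0.
  by move: x1; case: (@eqP _ (forcing x) 1) => [-> /eqP //|_]; case: ifP.
have [a [b [c [a0 b0 c0 ex]]]] := forcing1_split x1.
exists [:: a, b, c, d & fs]; last by rewrite ex.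
rewrite IHn /= a0 b0 c0 d0 fs0 /=; apply/andP; split=> //.
by move: sumfs; rewrite ex fsize_cat /=; lia.
Qed.

Lemma uniq_unforced n r : uniq (unforced n r).
Proof.
elim: n r => [|n IHn] r //; elim: r => //= r IHr.
rewrite cat_uniq map_inj_uniq ?IHr /=; last by move=> ? ? [].
apply/andP; split.
  apply/hasPn => _ /mapP[gs + ->]; rewrite mem_unforced => /and3P[].
  by case: gs => [|a [|b [|c [|e gs]]]] //= _ _ _; apply/mapP => -[].
rewrite map_inj_in_uniq // => gs hs; rewrite !mem_unforced.
case: gs => [|a [|b [|c [|e gs]]]]; rewrite /unforced_spec //=.
case: hs => [|a' [|b' [|c' [|e' hs]]]] //=; rewrite ?andbF //.
case/and3P=> _ /and5P[/eqP a0 /eqP b0 _ _ _] _ /and3P[_ /and5P[/eqP a0' /eqP b0' _ _ _] _].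
by case=> /graft_inj[] // -> -> -> -> ->.
Qed.

(** The default [Emp] is never reached, as the lists in [unforced n 3] have length three. *)
Definition isolated_forests n :=
  [seq (if fs is [:: a; b; c] then fcat a (Node b c) else Emp) | fs <- unforced n 3].

Lemma mem_isolated_forests n F :
  (F \in isolated_forests n) = (forcing F == 1) && (fsize F == n.*2.+1).
Proof.
apply/mapP/andP => [[fs]|[/eqP F1 szF]].
  rewrite mem_unforced => /and3P[]; case: fs => [|a [|b [|c []]]] //= _.
  case/and4P=> /eqP a0 /eqP b0 /eqP c0 _ sum ->.
  by rewrite forcing_graft // fsize_cat /=; split=> //; lia.
have [a [b [c [a0 b0 c0 eF]]]] := forcing1_split F1.
exists [:: a; b; c] => //; rewrite mem_unforced /unforced_spec /= a0 b0 c0 /=.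
by move: szF; rewrite eF fsize_cat /=; lia.
Qed.

Lemma uniq_isolated_forests n : uniq (isolated_forests n).
Proof.
rewrite map_inj_in_uniq ?uniq_unforced // => gs hs; rewrite !mem_unforced.
case/and3P; case: gs => [|a [|b [|c []]]] //= _ /and4P[/eqP a0 /eqP b0 _ _] _.
case/and3P; case: hs => [|a' [|b' [|c' []]]] //= _ /and4P[/eqP a0' /eqP b0' _ _] _.
by case/graft_inj=> // -> -> ->.
Qed.

(** The Fuss-Catalan count for triples, simplified by absorbing the factor [4 * n + 3] into the
    binomial coefficient. *)
Lemma size_isolated_forests n : size (isolated_forests n) * n.+1 = 'C(4 * n + 2, n).
Proof.
rewrite size_map; have := size_unforced n 3.
have := mul_bin_down (4 * n + 2).+1 n.
have -> : 4 * n + 3 = (4 * n + 2).+1 by lia.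
rewrite /=; set C := 'C(_, n); set D := 'C(_, n); set s := size _ => eC eS.
apply/eqP; rewrite -(eqn_pmul2l (_ : 0 < (4 * n + 2).+1)) //.
have {}eC : (4 * n + 2).+1 * C = 3 * n.+1 * D by rewrite eC; congr (_ * _); lia.
by rewrite eC mulnCA mulnA eS; apply/eqP; lia.
Qed.

(** * Counting caterpillars *)

(** The index 1 is a separate base case because the two extensions of [Emp] coincide. *)
Fixpoint chains j :=
  match j with
  | 0 => [:: Emp]
  | 1 => [:: antiblock]
  | j'.+1 => [seq Node Emp (Node c Emp) | c <- chains j'] ++
             [seq Node c leaf | c <- chains j']
  end.

Lemma chainsSS j : chains j.+2 =
  [seq Node Emp (Node c Emp) | c <- chains j.+1] ++ [seq Node c leaf | c <- chains j.+1].
Proof. by []. Qed.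

Lemma mem_chains j c : (c \in chains j) = chain c && (fsize c == j.*2).
Proof.
elim: j c => [|[|j] IHj] c.
- rewrite inE; apply/eqP/andP => [->|[_ /eqP/fsize0]] //.
- rewrite inE; apply/eqP/andP => [->|[chc /eqP szc]] //.
  by have [ec|//] := fsize2 szc; rewrite ec in chc.
rewrite chainsSS mem_cat; apply/orP/andP => [[]/mapP[d]|[chc /eqP szc]].
- by rewrite IHj => /andP[chd szd] -> /=; rewrite chd; split=> //; lia.
- rewrite IHj => /andP[chd szd] ->; split; last by rewrite /=; lia.
  by apply: chain_Node => //; right.
case: (chainP chc) szc => //= a b cha chb [->|->] szc.
  by left; apply: map_f; rewrite IHj chb /=; rewrite /= in szc; lia.
by right; apply/mapP; exists a; rewrite // IHj cha /=; rewrite /= in szc; lia.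
Qed.

Lemma uniq_chains j : uniq (chains j).
Proof.
elim: j => [|[|j] IHj] //; rewrite chainsSS cat_uniq.
rewrite !map_inj_uniq ?IHj ?andbT ?andTb; try by move=> ? ? [].
apply/hasPn => _ /mapP[c + ->]; rewrite mem_chains => /andP[_ szc].
by apply/mapP => -[d _ [ec]]; rewrite ec /= in szc.
Qed.

Lemma size_chains j : size (chains j.+1) = 2 ^ j.
Proof.
elim: j => // j IHj; rewrite chainsSS size_cat !size_map IHj expnS; lia.
Qed.

Fixpoint chains_upto m := if m is m'.+1 then chains_upto m' ++ chains m'.+1 else [::].

Lemma chains_uptoS m : chains_upto m.+1 = chains_upto m ++ chains m.+1.
Proof. by []. Qed.

Lemma mem_chains_upto m c :
  (c \in chains_upto m) = [&& chain c, c != Emp & fsize c <= m.*2].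
Proof.
elim: m => [|m IHm].
  rewrite in_nil; apply/esym/negP => /and3P[_ /eqP c0].
  by rewrite leqn0 => /eqP/fsize0.
rewrite chains_uptoS mem_cat IHm mem_chains.
have [chc|//] /= := boolP (chain c).
have := chain_even chc; case: eqP => [->|_] //= ev; lia.
Qed.

Lemma uniq_chains_upto m : uniq (chains_upto m).
Proof.
elim: m => // m IHm; rewrite chains_uptoS cat_uniq IHm uniq_chains andbT.
apply/hasPn => c; rewrite mem_chains mem_chains_upto => /andP[_ /eqP->].
by rewrite andbA; apply/negP => /andP[_]; lia.
Qed.

Definition chain_pairs t :=
  (* The bound [t.-1] leaves at least two edges for [b]. *)
  [seq (a, b) | a <- chains_upto t.-1, b <- chains (t - (fsize a)./2)].

Lemma mem_chain_pairs t a b : ((a, b) \in chain_pairs t) =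
  [&& chain a, chain b, a != Emp, b != Emp & fsize a + fsize b == t.*2].
Proof.
apply/allpairsPdep/and5P => [[x [y [+ + [-> ->]]]]|[cha chb a0 b0 sz]].
  rewrite mem_chains_upto mem_chains => /and3P[chx x0 szx] /andP[chy szy].
  have evx := chain_even chx; have evy := chain_even chy.
  have x_gt0 : 0 < fsize x by rewrite lt0n; apply: contra x0 => /eqP/fsize0->.
  split=> //; last by lia.
  by apply/eqP => y0; rewrite y0 /= in szy; lia.
exists a, b; rewrite mem_chains_upto mem_chains cha chb a0 /=.
have eva := chain_even cha; have evb := chain_even chb.
have b_gt0 : 0 < fsize b by rewrite lt0n; apply: contra b0 => /eqP/fsize0->.
by split=> //; lia.
Qed.

Lemma uniq_chain_pairs t : uniq (chain_pairs t).
Proof.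
apply: allpairs_uniq_dep => [|a _|]; rewrite ?uniq_chains ?uniq_chains_upto //.
by move=> [a b] [a' b'] _ _ /= [-> ->].
Qed.

Lemma size_chain_pairs t : size (chain_pairs t.+1) * 2 = t * 2 ^ t.
Proof.
rewrite size_allpairs_dep /=.
suff sum m : m <= t ->
    sumn [seq size (chains (t.+1 - (fsize a)./2)) | a <- chains_upto m] * 2 = m * 2 ^ t.
  exact: sum.
elim: m => // m IHm le_m; rewrite chains_uptoS map_cat sumn_cat mulnDl IHm 1?ltnW //.
have -> : [seq size (chains (t.+1 - (fsize a)./2)) | a <- chains m.+1] =
          [seq 2 ^ (t - m.+1) | a <- chains m.+1].
  apply/eq_in_map => a; rewrite mem_chains => /andP[_ /eqP->].
  by rewrite doubleK subSn // size_chains.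
have sum_const k (cs : seq forest) : sumn [seq k | _ <- cs] = size cs * k.
  by elim: cs => //= _ cs ->; rewrite mulSn.
rewrite sum_const size_chains -expnD -expnSr mulSn addnC; congr (2 ^ _ + _); lia.
Qed.

Definition caterpillars1 c :=
  [:: Node (Node Emp (Node c Emp)) Emp; Node (Node c leaf) Emp; Node c (Node Emp leaf);
      Node Emp (Node c leaf); Node Emp (Node Emp (Node c Emp))].

Definition caterpillars2 p :=
  let: (a, b) := p in
  [:: Node (Node a (Node b Emp)) Emp; Node Emp (Node a (Node b Emp));
      Node a (Node Emp (Node b Emp)); Node a (Node b leaf)].

(* A caterpillar with [2 t + 3] edges, cut at an edge or an inner vertex of the
   root region, falls into chains of which one or two are not single leaves. *)
Definition caterpillars t :=
  flatten (map caterpillars1 (chains t)) ++ flatten (map caterpillars2 (chain_pairs t)).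

(** Single chains contribute [5 * 2 ^ t] and pairs contribute four times half of [t * 2 ^ t]. *)
Lemma size_caterpillars t : size (caterpillars t.+1) = (2 * t + 5) * 2 ^ t.
Proof.
have size_flat (T : Type) (f : T -> seq forest) n s : (forall x, size (f x) = n) ->
    size (flatten (map f s)) = size s * n.
  by move=> szf; elim: s => //= x s IHs; rewrite size_cat szf IHs.
rewrite size_cat (size_flat _ _ 5) // (size_flat _ _ 4); last by case.
by rewrite size_chains; have := size_chain_pairs t; lia.
Qed.

Lemma mem_chains_neq t c : 0 < t -> c \in chains t -> c <> Emp.
Proof. by rewrite mem_chains => t_gt0 /andP[_ /eqP szc] c0; rewrite c0 /= in szc; lia. Qed.

Lemma uniq_caterpillars t : 0 < t -> uniq (caterpillars t).
Proof.
move=> t_gt0; have uniq_flat (T : eqType) (f : T -> seq forest) s : uniq s ->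
    {in s, forall x, uniq (f x)} ->
    (forall x y F, x \in s -> y \in s -> F \in f x -> F \in f y -> x = y) ->
  uniq (flatten (map f s)).
  elim: s => //= x s IHs /andP[xs Us] Uf inj; rewrite cat_uniq Uf ?mem_head //= IHs //.
  - rewrite andbT; apply/hasPn => F /flatten_mapP[y ys Fy]; apply: contraNN xs => Fx.
    by rewrite (inj x y F) ?mem_head // inE ys orbT.
  - by move=> y ys; apply: Uf; rewrite inE ys orbT.
  - by move=> y z F ys zs; apply: inj; rewrite inE ?ys ?zs orbT.
rewrite cat_uniq; apply/and3P; split.
- apply: uniq_flat => [|c ct|c d F ct dt]; first exact: uniq_chains.
    have c0 := mem_chains_neq t_gt0 ct.
    rewrite /caterpillars1 /= !inE.
    by rewrite !negb_or; repeat (apply/andP; split => //); apply/eqP => -[] *; subst.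
  have c0 := mem_chains_neq t_gt0 ct; have d0 := mem_chains_neq t_gt0 dt.
  rewrite !inE => /or4P[|||/orP[]] /eqP-> /or4P[|||/orP[]] /eqP[] *; by subst.
- apply/hasPn => F /flatten_mapP[[a b]];
  rewrite mem_chain_pairs => /and5P[_ _ /eqP a0 /eqP b0 _] Fab.
  apply/negP => /flatten_mapP[c ct]; have c0 := mem_chains_neq t_gt0 ct.
  by move: Fab; rewrite !inE => /or4P[] /eqP-> /or4P[|||/orP[]] /eqP[] *; subst.
apply: uniq_flat => [|[a b] abt|[a b] [a' b'] F]; first exact: uniq_chain_pairs.
  move: abt; rewrite mem_chain_pairs => /and5P[_ _ /eqP a0 /eqP b0 _].
  rewrite /caterpillars2 /= !inE.
  by rewrite !negb_or; repeat (apply/andP; split => //); apply/eqP => -[] *; subst.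
rewrite !mem_chain_pairs => /and5P[_ _ /eqP a0 /eqP b0 _] /and5P[_ _ /eqP a0' /eqP b0' _].
by rewrite !inE => /or4P[] /eqP-> /or4P[] /eqP[] *; subst.
Qed.

Lemma mem_caterpillars t F : 0 < t ->
  (F \in caterpillars t) = caterpillar F && (fsize F == t.*2 + 3).
Proof.
move=> t_gt0; rewrite mem_cat; apply/orP/andP.
  case=> /flatten_mapP[].
    move=> c ct; have c0 := mem_chains_neq t_gt0 ct.
    move: ct; rewrite mem_chains => /andP[chc /eqP szc].
    by rewrite !inE => /or4P[|||/orP[]] /eqP->; rewrite /= chc ?inE ?eqxx ?orbT; split=> //; lia.
  move=> [a b]; rewrite mem_chain_pairs => /and5P[cha chb a0 b0 /eqP sz].
  by rewrite !inE => /or4P[] /eqP->; rewrite /= cha chb ?inE ?eqxx ?orbT; split=> //; lia.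
have one c : chain c -> fsize c = t.*2 -> c \in chains t by rewrite mem_chains => -> /eqP.
have two a b : chain a -> chain b -> a != Emp -> b != Emp -> fsize a + fsize b = t.*2 ->
    (a, b) \in chain_pairs t by rewrite mem_chain_pairs => -> -> -> -> /eqP.
case; case: F => [|u [|v [|w [|? ?]]]] //; first case: u => [|a [|b []]] //.
- move=> /andP[cha chb] /eqP /= sz.
  have [a0|a0] := eqVneq a Emp; last have [b0|b0] := eqVneq b Emp.
  + by left; apply/flatten_mapP; exists b;
      [apply: one => //; rewrite a0 /= in sz; lia|rewrite a0 !inE eqxx].
  + by left; apply/flatten_mapP; exists a;
      [apply: one => //; rewrite b0 /= in sz; lia|rewrite b0 !inE eqxx orbT].
  + by right; apply/flatten_mapP; exists (a, b); [apply: two => //; lia|rewrite !inE eqxx].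
case/and4P=> chu chv chw; rewrite !inE => emp /eqP /= sz.
have [u0|u0] := eqVneq u Emp; have [v0|v0] := eqVneq v Emp; have [w0|w0] := eqVneq w Emp.
- by rewrite u0 v0 w0 /= in sz; lia.
- by left; apply/flatten_mapP; exists w;
    [apply: one => //; rewrite u0 v0 /= in sz; lia|rewrite u0 v0 !inE eqxx !orbT].
- by left; apply/flatten_mapP; exists v;
    [apply: one => //; rewrite u0 w0 /= in sz; lia|rewrite u0 w0 !inE eqxx !orbT].
- by right; apply/flatten_mapP; exists (v, w);
    [apply: two => //; rewrite u0 /= in sz; lia|rewrite u0 !inE eqxx !orbT].
- by left; apply/flatten_mapP; exists u;
    [apply: one => //; rewrite v0 w0 /= in sz; lia|rewrite v0 w0 !inE eqxx !orbT].
- by right; apply/flatten_mapP; exists (u, w);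
    [apply: two => //; rewrite v0 /= in sz; lia|rewrite v0 !inE eqxx !orbT].
- by right; apply/flatten_mapP; exists (u, v);
    [apply: two => //; rewrite w0 /= in sz; lia|rewrite w0 !inE eqxx !orbT].
- by case/or3P: emp => /eqP e; [rewrite -e eqxx in u0|rewrite -e eqxx in v0|rewrite -e eqxx in w0].
Qed.

(** * Matchings as forests *)

(** The partner of the first point cuts the interval into two parts closed under [p], the points
    below the first edge and those after it. *)
Lemma exists_forest (p : nat -> nat) a n :
    (forall i, a <= i < a + n -> [/\ a <= p i < a + n, p (p i) = i & p i <> i]) ->
    (forall i j, a <= i < a + n -> i < j < p i -> i < p j < p i) ->
  exists F, (fsize F).*2 = n /\ forall i, i < n -> p (a + i) = a + mate F i.
Proof.
have [m] := ubnP n; elim: m n a => // m IHm n a le_n pP nc.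
have [->|n_gt0] := posnP n; first by exists Emp.
have [pa_in ppa pa_neq] := pP a ltac:(lia).
have [|||c [szc mc]] := IHm (p a - a.+1) a.+1; first lia.
- move=> i i_in; have [pi_in ppi pi_neq] := pP i ltac:(lia).
  by have := nc a i ltac:(lia); split=> //; lia.
- by move=> i j i_in; apply: nc; lia.
have [|||r [szr mr]] := IHm (a + n - (p a).+1) (p a).+1; first lia.
- move=> i i_in; have [pi_in ppi pi_neq] := pP i ltac:(lia); split=> //.
  have := nc a (p i) ltac:(lia); rewrite ppi.
  have : p i <> a by move=> e; move: i_in; rewrite -ppi e; lia.
  have : p i <> p a by move=> e; move: ppi; rewrite e ppa; lia.
  lia.
- by move=> i j i_in; apply: nc; lia.
exists (Node c r); split=> [|i lt_i]; first by move=> /=; lia.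
have lt_i' : i < (fsize (Node c r)).*2 by move=> /=; lia.
case: (nodeP lt_i') => [|j j_c||j j_r].
- by rewrite addn0; lia.
- by rewrite addnS -addSn mc; lia.
- have -> : a + (fsize c).*2.+1 = p a by lia.
  by rewrite ppa addn0.
- have -> : a + ((fsize c).*2.+2 + j) = (p a).+1 + j by lia.
  by rewrite mr; lia.
Qed.

Definition opp k F (i : point k) : point k := insubd i (mate F i).

Definition edges k F : {set {set point k}} := [set [set i; opp F i] | i : point k].

Lemma val_opp k F (i : point k) : fsize F = k -> opp F i = mate F i :> nat.
Proof. by move=> szF; have := @mate_lt F i; rewrite szF ltn_ord val_insubd => ->. Qed.

Lemma oppK k F : fsize F = k -> involutive (@opp k F).
Proof. by move=> szF i; apply: val_inj; rewrite /= !val_opp // mateK // szF. Qed.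

Lemma opp_neq k F (i : point k) : fsize F = k -> opp F i != i.
Proof. by move=> szF; rewrite -val_eqE /= val_opp // mate_neq // szF. Qed.

Lemma mem_edge k F e (i : point k) : fsize F = k -> e \in edges k F ->
  i \in e -> e = [set i; opp F i].
Proof.
move=> szF /imsetP[j _ ->]; rewrite !inE => /orP[]/eqP-> //.
by rewrite oppK // setUC.
Qed.

Lemma edge_opp k F (i j : point k) : fsize F = k -> ([set i; j] \in edges k F) = (j == opp F i).
Proof.
move=> szF; apply/idP/eqP => [eF|->]; last exact: imset_f.
have e := mem_edge szF eF (set21 i j).
have : opp F i \in [set i; j] by rewrite e set22.
by rewrite !inE (negPf (opp_neq _ szF)) => /eqP.
Qed.

Lemma is_matching_edges k F : fsize F = k -> is_matching (edges k F).
Proof.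
move=> szF; apply/and3P; split.
- by apply/forall_inP => _ /imsetP[i _ ->]; rewrite cards2 [i == _]eq_sym opp_neq.
- apply/forallP => p; apply/eqP; rewrite -(cards1 [set p; opp F p]); congr #|pred_of_set _|.
  apply/setP => e; rewrite !inE; apply/andP/eqP => [[eF pe]|->]; first exact: mem_edge.
  by rewrite set21 edge_opp ?eqxx.
have ncross e f : e \in edges k F -> f \in edges k F -> ~~ cross_ord e f.
  move=> eF fF; apply/negP => /existsP[a /existsP[b /existsP[c /existsP[d]]]].
  case/and5P=> /eqP ee /eqP ef ac cb bd.
  move: eF fF; rewrite ee ef !edge_opp // => /eqP eb /eqP ed.
  by move: cb bd; rewrite eb ed !val_opp // => cb bd;
    have := @mate_nc F a c; rewrite szF; have := ltn_ord c; lia.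
by apply/forall_inP => e eF; apply/forall_inP => f fF; rewrite negb_or !ncross.
Qed.

Lemma cross_ordI k (a b c d : point k) : a < c -> c < b -> b < d -> cross_ord [set a; b] [set c; d].
Proof.
move=> ac cb bd; apply/existsP; exists a; apply/existsP; exists b.
by apply/existsP; exists c; apply/existsP; exists d; rewrite !eqxx ac cb bd.
Qed.

Lemma exists_edges k (M : {set {set point k}}) : is_matching M ->
  exists F, fsize F = k /\ edges k F = M.
Proof.
case/and3P=> /forall_inP card2 /forallP uniqM /forall_inP ncM.
have memM p : exists q, q != p /\ [set p; q] \in M.
  have /cards1P[e ee] := uniqM p.
  have : e \in [set e in M | p \in e] by rewrite ee set11.
  rewrite inE => /andP[eM pe]; have /cards2P[x [y [xy exy]]] := card2 e eM.
  move: pe eM; rewrite exy !inE => /orP[]/eqP-> eM; first by exists y; rewrite eq_sym.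
  by exists x; rewrite setUC.
pose m p := odflt p [pick q | (q != p) && ([set p; q] \in M)].
have mP p : m p != p /\ [set p; m p] \in M.
  rewrite /m; case: pickP => [q /andP[]//|no]; have [q [qp qM]] := memM p.
  by have := no q; rewrite qp qM.
have m_uniq p e : e \in M -> p \in e -> e = [set p; m p].
  move=> eM pe; have /cards1P[f ef] := uniqM p.
  have : e \in [set e in M | p \in e] by rewrite inE eM.
  have : [set p; m p] \in [set e in M | p \in e] by rewrite inE set21 (mP p).2.
  by rewrite ef !inE => /eqP-> /eqP.
have mK p : m (m p) = p.
  have e := m_uniq (m p) _ (mP p).2 (set22 _ _).
  have : p \in [set m p; m (m p)] by rewrite -e set21.
  by rewrite !inE eq_sym (negPf (mP p).1) => /eqP.
have m_nc (i j : point k) : i < j -> j < m i -> i < m j < m i.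
  move=> ij jm; have ncij := forall_inP (ncM _ (mP i).2) _ (mP j).2.
  have m_inj q r : m q = m r -> q = r by move=> e; rewrite -[q]mK e mK.
  have : m j != i by apply/eqP => e; move: jm; rewrite -e mK ltnn.
  have : m j != m i by apply/eqP => /m_inj e; move: ij; rewrite e ltnn.
  rewrite -!val_eqE /= => mj_mi mj_i; move: ncij; rewrite negb_or => /andP[nc1 nc2].
  apply/andP; split; rewrite ltn_neqAle ?mj_mi 1?eq_sym ?mj_i /= leqNgt; apply/negP => lt.
    by move/negP: nc2; apply; rewrite [[set j; _]]setUC; apply: cross_ordI.
  by move/negP: nc1; apply; apply: cross_ordI.
pose p x := if insub x is Some i then nat_of_ord (m i) else 0.
have pE (i : point k) : p i = m i by rewrite /p valK.
have [||F [szF mF]] := @exists_forest p 0 k.*2.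
- move=> i /= lt_i; rewrite -[i]/(nat_of_ord (Ordinal lt_i)) !pE mK ltn_ord.
  by split=> //; apply/eqP; rewrite val_eqE (mP _).1.
- move=> i j /= lt_i; rewrite -[i]/(nat_of_ord (Ordinal lt_i)) pE => /andP[ij jm].
  have lt_j : j < k.*2 := ltn_trans jm (ltn_ord _).
  by rewrite -[j]/(nat_of_ord (Ordinal lt_j)) pE m_nc.
have {}szF : fsize F = k by apply: double_inj.
have opp_m i : opp F i = m i by apply: val_inj; rewrite /= val_opp // -pE -[LHS]mF.
exists F; split=> //; apply/setP => e; apply/imsetP/idP => [[i _ ->]|eM].
  by rewrite opp_m (mP i).2.
have /cards2P[x [y [_ exy]]] := card2 e eM; exists x => //.
by rewrite opp_m; apply: m_uniq; rewrite // exy set21.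
Qed.

Lemma compatible_edges k F G : fsize F = k -> fsize G = k ->
  [disjoint edges k F & edges k G] &&
    [forall e in edges k F, forall f in edges k G, ~~ crossing e f] = adj F G.
Proof.
move=> szF szG; apply/andP/idP => [[disj /forall_inP nc]|adjFG].
  apply/adjP; rewrite szF szG; split=> // [i lt_i|i j lt_j ij].
    apply/eqP => e; have /pred0P/(_ [set Ordinal lt_i; opp F (Ordinal lt_i)]) := disj.
    rewrite /= !edge_opp // eqxx /= => /eqP; apply; apply: val_inj.
    by rewrite /= !val_opp.
  have lt_i : i < k.*2 by lia.
  pose i' : point k := Ordinal lt_i; pose j' : point k := Ordinal lt_j.
  have := forall_inP (nc [set i'; opp F i'] (imset_f _ isT)) [set j'; opp G j'] (imset_f _ isT).
  rewrite negb_or => /andP[nc1 nc2]; apply/andP; split; rewrite leqNgt; apply/negP => lt.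
    move/negP: nc2; apply; rewrite [[set j'; _]]setUC; apply: cross_ordI => //=.
    - by rewrite val_opp.
    - by case/andP: ij.
    - by rewrite val_opp //=; case/andP: ij.
  by move/negP: nc1; apply; apply: cross_ordI; rewrite /= ?val_opp //; case/andP: ij.
have ncross F' G' e f : fsize F' = k -> fsize G' = k -> adj F' G' ->
    e \in edges k F' -> f \in edges k G' -> ~~ cross_ord e f.
  move=> szF' szG' /adjP[_ _ nc] eF fG.
  apply/negP => /existsP[a /existsP[b /existsP[c /existsP[d]]]].
  case/and5P=> /eqP ee /eqP ef ac cb bd.
  move: eF fG; rewrite ee ef !edge_opp // => /eqP eb /eqP ed.
  move: cb bd; rewrite eb ed !val_opp // => cb bd.
  by have := nc a c; rewrite szF'; have := ltn_ord c; lia.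
split; last first.
  apply/forall_inP => e eF; apply/forall_inP => f fG; rewrite negb_or.
  by rewrite (ncross F G) // (ncross G F) // adj_sym.
apply/pred0P => e /=; apply/negP => /andP[/imsetP[i _ ->]].
rewrite edge_opp // => /eqP eq_i; have /adjP[_ /(_ i)] := adjFG.
by rewrite szF ltn_ord -val_opp // eq_i val_opp // eqxx => /(_ isT).
Qed.

(** The boolean form of [exists_edges], from which [xchoose] extracts a forest. *)
Lemma exists_forest_of k (M : matching k) : exists F, (fsize F == k) && (edges k F == val M).
Proof.
by have [F [szF eF]] := exists_edges (valP M); exists F; rewrite szF eF !eqxx.
Qed.

Definition forest_of k (M : matching k) : forest := xchoose (exists_forest_of M).

Lemma fsize_forest_of k (M : matching k) : fsize (forest_of M) = k.
Proof. by have /andP[/eqP] := xchooseP (exists_forest_of M). Qed.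

Lemma edges_forest_of k (M : matching k) : edges k (forest_of M) = val M.
Proof. by have /andP[_ /eqP] := xchooseP (exists_forest_of M). Qed.

Lemma forest_of_inj k : injective (@forest_of k).
Proof. by move=> M N e; apply: val_inj; rewrite -!edges_forest_of e. Qed.

Lemma forest_of_surj k F : fsize F = k -> exists M : matching k, forest_of M = F.
Proof.
move=> szF; pose M : matching k := Sub (edges k F) (is_matching_edges szF); exists M.
have szM := fsize_forest_of M; apply: mate_inj => [|i]; rewrite szM // => lt_i.
have := eqxx (opp F (Ordinal lt_i)).
rewrite -(edge_opp _ _ szF) -[edges k F]/(val M) -edges_forest_of edge_opp // => /eqP e.
by have := congr1 val e; rewrite /= !val_opp.
Qed.

Lemma dcm_adj k (M N : matching k) : dcm M N = adj (forest_of M) (forest_of N).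
Proof. by rewrite -(compatible_edges (k := k)) ?fsize_forest_of // !edges_forest_of. Qed.

Lemma connect_conn k (M N : matching k) :
  reflect (conn (forest_of M) (forest_of N)) (connect (@dcm k) M N).
Proof.
apply: (iffP connectP) => [[p + ->]|cMN].
  elim: p M => [|N' p IHp] M /=; first by move=> _; apply: Conn0.
  rewrite dcm_adj => /andP[/conn1 cMN' /IHp]; exact: conn_trans.
apply/connectP; move: cMN; move: {-1}(forest_of N) (erefl (forest_of N)) => F eF cMF.
elim: cMF N eF => [|G H cMG IH adjGH] N eN; first by rewrite (forest_of_inj eN) connect0.
have [N' eN'] : exists N', @forest_of k N' = G.
  by apply: forest_of_surj; rewrite (adj_size adjGH) -eN fsize_forest_of.
by apply: connect_trans (IH N' eN') (connect1 _); rewrite dcm_adj eN' eN.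
Qed.

Lemma mem_component k (M N : matching k) :
  reflect (conn (forest_of M) (forest_of N)) (N \in component M).
Proof. by rewrite inE; apply: connect_conn. Qed.

Lemma component_self k (M : matching k) : M \in component M.
Proof. by apply/mem_component/Conn0. Qed.

Lemma component_eq k (M N : matching k) : N \in component M -> component N = component M.
Proof.
move=> /mem_component cMN; apply/setP => X; apply/mem_component/mem_component.
  exact: conn_trans.
exact/conn_trans/conn_sym.
Qed.

Lemma card_forest_of k (A : {set matching k}) (L : seq forest) : uniq L ->
    {in L, forall F, fsize F = k} ->
    (forall M, (M \in A) = (forest_of M \in L)) ->
  #|A| = size L.
Proof.
move=> UL szL memA; rewrite cardE -(size_map (@forest_of k)); apply/perm_size.
apply: uniq_perm => //; first by rewrite map_inj_uniq ?enum_uniq //; apply: forest_of_inj.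
move=> F; apply/mapP/idP => [[M]|FL]; first by rewrite mem_enum memA => ML ->.
by have [M eM] := forest_of_surj (szL F FL); exists M; rewrite // mem_enum memA eM.
Qed.

Lemma card_component_ge k (M : matching k) m : order_ge (forest_of M) m -> m <= #|component M|.
Proof.
case=> us [Uus <- cus]; rewrite cardE -(size_map (@forest_of k)).
apply: uniq_leq_size => // F /cus cF.
have [N eN] : exists N, @forest_of k N = F.
  by apply: forest_of_surj; rewrite -(conn_size cF) fsize_forest_of.
by rewrite -eN map_f // mem_enum; apply/mem_component; rewrite eN.
Qed.

(** * Orders and shapes of the components of matchings *)

Lemma isolated_conn F G : (forall X, ~~ adj F X) -> conn F G -> G = F.
Proof. by move=> isoF; elim=> // {}G H _ -> /(elimN idP (isoF H)). Qed.

Lemma card_component_isolated k (M : matching k) : odd k ->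
  (#|component M| == 1) = (forcing (forest_of M) == 1).
Proof.
move=> ok; have szM := fsize_forest_of M; apply/cards1P/eqP => [[N eN]|/isolated_forcing iso].
  apply/eqP; apply: contraT => /forcing_neighbor[|G adjG]; first by rewrite szM.
  have [X eX] : exists X, @forest_of k X = G.
    by apply: forest_of_surj; rewrite -(adj_size adjG).
  have : X \in component M by apply/mem_component; rewrite eX; apply: conn1.
  have := component_self M; rewrite eN !inE => /eqP eM /eqP eXN.
  by move: adjG; rewrite -eX eXN eM adj_irr // fsize_forest_of; case: (k) ok.
exists M; apply/setP => N; rewrite in_set1; apply/mem_component/eqP => [/isolated_conn e|->].
  by apply: forest_of_inj; apply: e.
exact: Conn0.
Qed.

Lemma conn_star N us G : (forall X, adj N X = (X \in us)) ->
    (forall X Y, X \in us -> adj X Y -> Y = N) ->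
  conn N G -> G \in N :: us.
Proof.
move=> adjus uniqus; elim=> [|X Y _ IH adjXY]; first exact: mem_head.
move: IH; rewrite !inE => /predU1P[eX|Xus]; last by rewrite (uniqus X Y) ?eqxx.
by rewrite -adjus -eX adjXY orbT.
Qed.

Lemma caterpillar_component k (N : matching k) : odd k -> caterpillar (forest_of N) ->
  #|component N| = k./2.+1 /\ is_star (component N).
Proof.
move=> ok /caterpillar_star[us [Uus szus adjus uniqus]].
have szN := fsize_forest_of N; have k_gt0 : 0 < k by case: (k) ok.
have irr (X : matching k) : adj (forest_of X) (forest_of X) = false.
  by rewrite adj_irr // fsize_forest_of.
have memC X : (X \in component N) = (forest_of X \in forest_of N :: us).
  apply/mem_component/idP => [/(conn_star adjus uniqus)//|].
  by rewrite inE -adjus => /predU1P[->|/conn1//]; apply: Conn0.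
split.
  rewrite (card_forest_of (L := forest_of N :: us)) //=.
  - by rewrite szus szN.
  - by rewrite Uus -adjus irr.
  - move=> F; rewrite inE -adjus => /predU1P[->//|/adj_size <- //].
apply/exists_inP; exists N; first exact: component_self.
apply/forall_inP => X; rewrite memC inE => hX; apply/forall_inP => Y; rewrite memC inE => hY.
rewrite dcm_adj; apply/eqP; move: hX hY; rewrite !(inj_eq (@forest_of_inj k)).
have [->|XN] := eqVneq X N; have [->|YN] //= := eqVneq Y N.
- by rewrite -adjus.
- move=> Xus _; rewrite -adjus in Xus; exact: adj_sym.
- move=> Xus Yus; apply/negP => /(uniqus _ _ Xus) /forest_of_inj e.
  by rewrite e eqxx in YN.
Qed.

Lemma component_order k (M : matching k) : odd k -> 3 <= k -> 1 < #|component M| ->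
  k./2.+1 <= #|component M| /\
  (#|component M| = k./2.+1 -> exists2 N, N \in component M & caterpillar (forest_of N)).
Proof.
move=> ok k3 C1; have szM := fsize_forest_of M.
have [||| ge eqM] := @order_ge_component (forest_of M); rewrite ?szM //; first exact: ltnW.
  apply: forcing_neighbor; rewrite ?szM // -(card_component_isolated _ ok).
  by rewrite gtn_eqF.
rewrite szM in ge eqM; split=> [|cardC]; first exact: card_component_ge.
case: eqM => [/card_component_ge|[F cF catF]]; first by rewrite cardC ltnn.
have [N eN] : exists N, @forest_of k N = F.
  by apply: forest_of_surj; rewrite -(conn_size cF).
by exists N; rewrite ?eN //; apply/mem_component; rewrite eN.
Qed.

Theorem theorem2 (k : nat) (hk : odd k) :
  let l := k.+1./2 in
  (* (1) smallest order is 1 (isolated vertices), counted *)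
  [exists C in components k, #|C| == 1] /\
  #|[set C in components k | #|C| == 1]| * l = 'C(4 * l - 2, l - 1) /\
  (* (2) second smallest order is l, realized by stars K_{1,l-1} *)
  (3 <= k ->
     [exists C in components k, #|C| == l] /\
     (forall C, C \in components k -> 1 < #|C| -> l <= #|C|) /\
     (forall C, C \in components k -> #|C| = l -> is_star C)) /\
  (5 <= k -> #|[set C in components k | #|C| == l]| = (2 * l - 1) * 2 ^ (l - 3)).
Proof.
move=> l; have el : l = k./2.+1 by rewrite /l; lia.
have memC (C : {set matching k}) : C \in components k -> exists M, C = component M.
  by case/imsetP => M _ ->; exists M.
have inC (M : matching k) : component M \in components k by apply: imset_f.
have card1 : #|[set C in components k | #|C| == 1]| = size (isolated_forests k./2).
  have -> : [set C in components k | #|C| == 1] =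
      [set component M | M in [set M : matching k | forcing (forest_of M) == 1]].
    apply/setP => C; rewrite inE; apply/andP/imsetP => [[/memC[M ->]]|[M + ->]].
      by rewrite card_component_isolated // => M1; exists M; rewrite ?inE.
    by rewrite inE -card_component_isolated.
  rewrite card_in_imset; last first.
    move=> M N; rewrite !inE -!card_component_isolated // => /cards1P[X eX] _ eMN.
    have := component_self M; have := component_self N; rewrite -eMN eX !inE.
    by move=> /eqP-> /eqP->.
  apply: card_forest_of; first exact: uniq_isolated_forests.
    by move=> F; rewrite mem_isolated_forests => /andP[_ /eqP->]; lia.
  move=> M; rewrite inE mem_isolated_forests fsize_forest_of.
  by rewrite andb_idr // => _; lia.
have card1l : #|[set C in components k | #|C| == 1]| * l = 'C(4 * l - 2, l - 1).
  rewrite card1 el size_isolated_forests; congr 'C(_, _); lia.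
split; last split=> //.
  have : 0 < #|[set C in components k | #|C| == 1]|.
    have : 0 < 'C(4 * l - 2, l - 1) by rewrite bin_gt0; lia.
    by rewrite -card1l muln_gt0 => /andP[].
  by case/card_gt0P => C; rewrite inE => /andP[CC C1]; apply/exists_inP; exists C.
have star_of (M : matching k) : 3 <= k -> #|component M| = l ->
    exists2 N, component M = component N & caterpillar (forest_of N).
  move=> k3 cardM; have [|_ /(_ _)[|N NM catN]] := @component_order k M hk k3.
  - by rewrite cardM el; lia.
  - by rewrite cardM.
  - by exists N; rewrite // (component_eq NM).
split=> [k3|k5].
  split; last split.
  - have [F [szF catF]] : exists F, fsize F = k /\ caterpillar F.
      (* For [k >= 5] a caterpillar exists because the list enumerating them has positive length. *)
      have [k_eq3|k_neq3] := eqVneq k 3; first by exists ring3.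
      have := size_caterpillars (k./2 - 2).
      have : 0 < (2 * (k./2 - 2) + 5) * 2 ^ (k./2 - 2) by rewrite muln_gt0 expn_gt0; lia.
      case E: (caterpillars _) => [|F L] /=; first by lia.
      have := mem_caterpillars F (ltn0Sn (k./2 - 2)).
      by rewrite E mem_head => /esym/andP[catF /eqP szF] _ _; exists F; split=> //; lia.
    have [M eM] := forest_of_surj szF; rewrite -eM in catF.
    have [cardM _] := caterpillar_component hk catF.
    by apply/exists_inP; exists (component M); rewrite // cardM el.
  - by move=> C /memC[M ->] /(component_order hk k3)[]; rewrite el.
  - move=> C /memC[M ->] /(star_of M k3)[N -> catN].
    by have [] := caterpillar_component hk catN.
have k2 : 1 < k./2 by lia.
have [t et] : exists t, k = t.+1.*2 + 3 by exists (k./2 - 2); lia.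
have -> : [set C in components k | #|C| == l] =
    [set component M | M in [set M : matching k | caterpillar (forest_of M)]].
  apply/setP => C; rewrite inE; apply/andP/imsetP => [[/memC[M ->] /eqP]|[M + ->]].
    by move/star_of => [|N -> catN]; [lia|exists N; rewrite ?inE].
  by rewrite inE => /(caterpillar_component hk)[-> _]; rewrite el.
(* A component contains only one caterpillar: a second one would be a leaf of the star, with a
   single neighbour, yet it has [k./2] neighbours. This needs [k >= 5], since both ends of a star
   with one edge are centres. *)
rewrite card_in_imset; last first.
  move=> M N; rewrite !inE => catM catN eMN.
  have /caterpillar_star[us [Uus szus adjus uniqus]] := catM.
  have /caterpillar_star[vs [Uvs szvs adjvs _]] := catN.
  have : N \in component M by rewrite eMN component_self.
  move/mem_component/(conn_star adjus uniqus); rewrite inE => /predU1P[/forest_of_inj->//|Nus].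
  have : size vs <= size [:: forest_of M].
    by apply: uniq_leq_size => // F; rewrite -adjvs => /(uniqus _ _ Nus)->; rewrite mem_head.
  by rewrite szvs fsize_forest_of leqNgt k2.
rewrite (card_forest_of (L := caterpillars t.+1)).
- by rewrite size_caterpillars el et; congr (_ * 2 ^ _); lia.
- exact: uniq_caterpillars.
- by move=> F; rewrite mem_caterpillars // => /andP[_ /eqP->].
- by move=> M; rewrite inE mem_caterpillars // fsize_forest_of -et eqxx andbT.
Qed.
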